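(* Let $\phi:\mathbb{R}\to\mathbb{R}$ be continuous and $1$-periodic, let $\epsilon>0$ and $p>1$, and let $k$ be a kernel such that (i) there is $L_k>0$ with $\|k(x)-k(x')\|_\infty\le L_k\|x-x'\|_\infty$ for all $x,x'\in\mathbb{R}^2$, and (ii) there is $C\ge 0$ with $\|k(x)\|_\infty\le C$ for every $x\in\Delta=\{(r,r): r\in\mathbb{R}\}$. Let $c\in[0,1]$ be a point at which $\phi$ attains its global maximum. Then, as $R\to\infty$, $$\left\|\overline{\rho}\big(D(\phi|_{[0,R]})\big)-\overline{\rho}\big(D(\phi|_{[c,c+1]})\big)\right\|_\infty\longrightarrow 0 .$$
   Context: **Persistence diagram.** For a continuous function $h:\mathbb{X}\to\mathbb{R}$ on a compact interval $\mathbb{X}$, let $\mathbb{X}_t=h^{-1}((-\infty,t])$ and define a persistence module by $V_t=H_0(\mathbb{X}_t)$ (singular homology with coefficients in a fixed field) if $t<\max h$ and $V_t=0$ if $t\ge\max h$; for $s\le t<\max h$ the map $V_s\to V_t$ is induced by inclusion, and for $t\ge \max h$ it is zero. All ranks $r(s,t)=\mathrm{rank}(V_s\to V_t)$, $s<t$, are finite. The persistence diagram $D(h)$ is the multiset consisting of every diagonal point $(r,r)$ with infinite multiplicity together with the unique locally finite multiset of points in $\{(b,d):b<d\}$ such that for all $a<b<c<d$ for which no point lies on the boundary of $[a,b]\times[c,d]$, the number of points (with multiplicity) in $[a,b]\times[c,d]$ equals $r(b,c)-r(a,c)-r(b,d)+r(a,d)$. **Kernel and functionals.** Let $\mathbb{T}$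 be a Euclidean space. A kernel is a map $k$ which associates to each $x=(b,d)\in\mathbb{R}^2$ a function $k(x):\mathbb{T}\to\mathbb{R}$; $\|\cdot\|_\infty$ denotes the sup norm for functions on $\mathbb{T}$ and the max norm on $\mathbb{R}^2$. With $w_\epsilon(b,d)=\max(d-b-\epsilon,0)$, the normalized functional of a persistence diagram $D$ is $$\overline{\rho}(D)(t)=\frac{\sum_{x\in D}w_\epsilon(x)^p\,k(x)(t)}{\sum_{x\in D}w_\epsilon(x)^p},\qquad t\in\mathbb{T},$$ if the denominator is positive, and $\overline{\rho}(D)=0$ otherwise. (Sums are over points with multiplicity; only finitely many points have $w_\epsilon>0$.) *)

(* Defs.v *)
From HB Require Import structures.
From mathcomp Require Import all_boot all_order all_algebra.
From mathcomp Require Import generic_quotient ring_quotient.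
From mathcomp Require Import all_classical all_reals all_analysis.
From mathcomp Require Import freeg.

Set Implicit Arguments.
Unset Strict Implicit.
Unset Printing Implicit Defensive.

Import Order.TTheory GRing.Theory Num.Theory.
Import numFieldNormedType.Exports.

Local Open Scope classical_set_scope.
Local Open Scope quotient_scope.
Local Open Scope ring_scope.

Section Cokernel.
Variables (F : fieldType) (U V : lmodType F) (f : {linear U -> V}).

Definition lin_range : {pred V} := fun v => v \in range f.

Lemma lin_rangeP v : reflect (exists u, f u = v) (v \in lin_range).
Proof.
apply: (iffP idP); first by rewrite unfold_in => /set_mem[u _ <-]; exists u.
by case=> u <-; rewrite unfold_in; apply/mem_set; exists u.
Qed.

Fact lin_range_zmod_closed : zmod_closed lin_range.
Proof.
split=> [|_ _ /lin_rangeP[u <-] /lin_rangeP[v <-]].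
  by apply/lin_rangeP; exists 0; rewrite raddf0.
by apply/lin_rangeP; exists (u - v); rewrite raddfB.
Qed.
HB.instance Definition _ :=
  GRing.isZmodClosed.Build V lin_range lin_range_zmod_closed.

Lemma lin_rangeZ a v : v \in lin_range -> a *: v \in lin_range.
Proof.
by move=> /lin_rangeP[u <-]; apply/lin_rangeP; exists (a *: u); rewrite linearZ.
Qed.

Definition coker : Type := Quotient.quot lin_range.
HB.instance Definition _ := GRing.Zmodule.on coker.
HB.instance Definition _ : EqQuotient V (Quotient.equiv lin_range) coker :=
  EqQuotient.on coker.

Definition coker_proj (v : V) : coker := \pi_coker v.

Lemma coker_proj_surj (q : coker) : exists v, coker_proj v = q.
Proof. by exists (repr q); rewrite /coker_proj reprK. Qed.

Lemma coker_projP v w :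
  coker_proj v = coker_proj w <-> exists u, f u = v - w.
Proof.
rewrite /coker_proj; split.
  by move=> /eqquotP; rewrite Quotient.equivE => /lin_rangeP.
by move=> h; apply/eqquotP; rewrite Quotient.equivE; apply/lin_rangeP.
Qed.

Lemma coker_projD : {morph coker_proj : v w / v + w}.
Proof.
move=> v w; rewrite /coker_proj.
exact: (raddfD \pi_(Quotient.quot lin_range)).
Qed.

Definition coker_scale (a : F) (q : coker) : coker := coker_proj (a *: repr q).

Lemma coker_scale_proj a v :
  coker_scale a (coker_proj v) = coker_proj (a *: v).
Proof.
apply/coker_projP; apply/lin_rangeP; rewrite -scalerBr; apply: lin_rangeZ.
by apply/lin_rangeP/coker_projP; rewrite /coker_proj reprK.
Qed.

Fact coker_scaleA a b q :
  coker_scale a (coker_scale b q) = coker_scale (a * b) q.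
Proof.
by have [v <-] := coker_proj_surj q; rewrite !coker_scale_proj scalerA.
Qed.

Fact coker_scale1 : left_id 1 coker_scale.
Proof.
by move=> q; have [v <-] := coker_proj_surj q; rewrite coker_scale_proj scale1r.
Qed.

Fact coker_scaleDr : right_distributive coker_scale +%R.
Proof.
move=> a q q'; have [[v <-] [w <-]] := (coker_proj_surj q, coker_proj_surj q').
by rewrite -coker_projD !coker_scale_proj scalerDr coker_projD.
Qed.

Fact coker_scaleDl q : {morph coker_scale^~ q : a b / a + b}.
Proof.
move=> a b; have [v <-] := coker_proj_surj q.
by rewrite !coker_scale_proj scalerDl coker_projD.
Qed.

HB.instance Definition _ := GRing.Zmodule_isLmodule.Build F coker
  coker_scaleA coker_scale1 coker_scaleDr coker_scaleDl.

End Cokernel.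

Section Rank.
Variables (F : fieldType) (U V : lmodType F).

Definition lin_indep n (e : 'I_n -> V) :=
  forall a : 'I_n -> F, \sum_i a i *: e i = 0 -> forall i, a i = 0.

Definition has_rank (f : U -> V) (n : nat) := exists e : 'I_n -> V,
  lin_indep e /\ range f = [set \sum_i a i *: e i | a in [set: 'I_n -> F]].

(* Total: 0 when the range of [f] is not finite-dimensional. *)
Definition rank (f : U -> V) : nat := xget 0%N [set n | has_rank f n].

End Rank.

Section FreeLift.
Variables (F : nzRingType) (K : choiceType) (M : lmodType F) (f : K -> M).

HB.instance Definition _ := Algebra.isZmodMorphism.Build {freeg K / F} M
  (fglift f) (lift_is_additive f).

Fact fglift_is_scalable : scalable (fglift f).
Proof.
move=> a D.
have aU c x : a *: << c *g x >> = << (a * c) *g x >> :> {freeg K / F}.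
  by apply/eqP/freeg_eqP => y; rewrite coeffZ !coeffU mulrA.
rewrite -[D]freeg_sumE; elim: (dom D) => [|x r IH].
  by rewrite big_nil !(scaler0, raddf0).
by rewrite big_cons scalerDr !raddfD /= IH aU !liftU -scalerA.
Qed.

HB.instance Definition _ := GRing.isScalable.Build F {freeg K / F} M *:%R
  (fglift f) fglift_is_scalable.

End FreeLift.

Section H0.
Variables (R : realType) (F : fieldType).

Definition unit_itv : set R := `[0, 1].

Lemma unit_itv0_subproof : (0 : R) \in unit_itv.
Proof. by apply/mem_set; rewrite /unit_itv /= in_itv /= lexx ler01. Qed.

Lemma unit_itv1_subproof : (1 : R) \in unit_itv.
Proof. by apply/mem_set; rewrite /unit_itv /= in_itv /= ler01 lexx. Qed.

Definition itv0 : unit_itv := SigSub unit_itv0_subproof.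
Definition itv1 : unit_itv := SigSub unit_itv1_subproof.

(* The standard 1-simplex is identified with [0, 1], and a singular 0-simplex
   with a point. *)
Definition simplex1 (X : topologicalType) := continuousType unit_itv X.

Definition chain0 (X : topologicalType) := {freeg X / F}.
Definition chain1 (X : topologicalType) := {freeg {classic simplex1 X} / F}.

Definition boundary1 (X : topologicalType) : {linear chain1 X -> chain0 X} :=
  fglift (fun s : {classic simplex1 X} =>
    << (s : simplex1 X) itv1 >> - << (s : simplex1 X) itv0 >> : chain0 X).

Definition H0 (X : topologicalType) : lmodType F := coker (boundary1 X).

Variables (X Y : topologicalType).

(* The descent of [fglift (fun x => << f x >>)] to homology, meaningful when
   [f] is continuous (see [H0_map_proj]). *)
Definition H0_map (f : X -> Y) (q : H0 X) : H0 Y :=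
  coker_proj (boundary1 Y)
    (fglift (fun x => << f x >> : chain0 Y) (repr (q : coker (boundary1 X)))).

Lemma H0_map_proj (f : X -> Y) (z : chain0 X) : continuous f ->
  H0_map f (coker_proj (boundary1 X) z) =
  coker_proj (boundary1 Y) (fglift (fun x => << f x >> : chain0 Y) z).
Proof.
move=> cf; apply/coker_projP.
have [u] : exists u, boundary1 X u
    = repr (coker_proj (boundary1 X) z : coker (boundary1 X)) - z.
  by apply/coker_projP; rewrite {1}/coker_proj reprK.
rewrite -raddfB => <-.
have post (s : simplex1 X) : continuous (f \o s).
  by move=> t; apply: continuous_comp; [exact: cts_fun | exact: cf].
pose fs (s : {classic simplex1 X}) : {classic simplex1 Y} :=
  HB.pack_for (simplex1 Y) (f \o (s : simplex1 X))
    (isContinuous.Build _ _ _ (post s)).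
exists (fglift (fun s => << fs s >> : chain1 Y) u).
rewrite -[u]freeg_sumE; elim: (dom u) => [|s r IH].
  by rewrite big_nil !raddf0.
rewrite big_cons !raddfD /= IH; congr (_ + _).
rewrite /boundary1 /= !liftU !linearZ /= !linearB /= !liftU !scale1r.
by rewrite scalerBr.
Qed.

End H0.

Section PersistenceModule.
Variables (R : realType) (F : fieldType) (h : R -> R) (X : set R).

Definition sublevel (t : R) : set R := X `&` [set x | h x <= t].

Lemma sublevelS s t : s < t -> sublevel s `<=` sublevel t.
Proof. by move=> st x [Xx /= hx]; split=> //=; exact: le_trans hx (ltW st). Qed.

(* For [X] compact nonempty and [h] continuous on [X], this is the maximum. *)
Definition hmax : R := sup (h @` X).

Definition pm_space (t : R) : lmodType F :=
  if t < hmax then H0 R F (sublevel t) else 'rV[F]_0.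

Definition pm_map s t (st : s < t) : pm_space s -> pm_space t :=
  match s < hmax as b, t < hmax as b' return
    ((if b then H0 R F (sublevel s) else 'rV[F]_0 : lmodType F) ->
     (if b' then H0 R F (sublevel t) else 'rV[F]_0 : lmodType F)) with
  | true, true => @H0_map R F _ _ (subfun (sublevelS st))
  | _, _ => fun=> 0
  end.

Definition pm_rank s t (st : s < t) : nat := rank (pm_map st).

End PersistenceModule.

(* [None] stands for infinite multiplicity. *)
Definition multiset (T : Type) := T -> option nat.

Definition mult (T : Type) (D : multiset T) (x : T) : nat := odflt 0%N (D x).

Section PersistenceDiagram.
Variables (R : realType) (F : fieldType) (h : R -> R) (X : set R).

Record is_persistence_diagram (D : multiset (R * R)) : Prop := {
  pd_diagonal : forall r, D (r, r) = None ;
  pd_below : forall x : R * R, x.2 < x.1 -> D x = Some 0%N ;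
  pd_finite : forall x : R * R, x.1 < x.2 -> D x != None ;
  pd_locally_finite : forall x : R * R, x.1 < x.2 -> exists2 U, nbhs x U &
    finite_set (U `&` [set y | y.1 < y.2 /\ D y != Some 0%N]) ;
  pd_rectangle : forall a b c d (ab : a < b) (bc : b < c) (cd : c < d),
    (forall x : R * R, ((`[a, b] `*` `[c, d]) `\` (`]a, b[ `*` `]c, d[)) x ->
       D x = Some 0%N) ->
    \sum_(x \in `[a, b] `*` `[c, d]) (mult D x)%:Z =
      (pm_rank F h X bc)%:Z - (pm_rank F h X (lt_trans ab bc))%:Z
      - (pm_rank F h X (lt_trans bc cd))%:Z
      + (pm_rank F h X (lt_trans ab (lt_trans bc cd)))%:Z
}.

End PersistenceDiagram.

Section Functional.
Variables (R : realType) (T : Type).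

Definition weight (eps : R) (x : R * R) : R := Num.max (x.2 - x.1 - eps) 0.

(* Sum of [f] over the points of [D], with multiplicity. Points of infinite
   multiplicity are discarded: in a persistence diagram they are the diagonal
   points, where the weight vanishes (convention 0 * oo = 0). *)
Definition msum (D : multiset (R * R)) (f : R * R -> R) : R :=
  \sum_(x \in [set: R * R]) f x *+ mult D x.

Definition rhobar (k : R * R -> T -> R) (eps p : R) (D : multiset (R * R))
    (t : T) : R :=
  let den := msum D (fun x => weight eps x `^ p) in
  if 0 < den then msum D (fun x => weight eps x `^ p * k x t) / den else 0.

Definition supnorm (f : T -> R) : \bar R :=
  ereal_sup [set `|f t|%:E | t in setT].

End Functional.

(* Main.v *)
(* Below the maximum M = phi c every sublevel set avoids the points c + i, so
   no component of a sublevel set of [0, r] crosses them: for s < t < M the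
   ranks satisfy r_[0,r](s,t) = N r_[c,c+1](s,t) + r_J(s,t), where N = floor(r
   - c) and J is the union of the two end pieces [0, c] and [c + N, r] of
   length at most 1. Reading multiplicities off ranks, D(phi|[0,r]) is N copies
   of D(phi|[c,c+1]) plus an excess. The excess is nonnegative because
   coarsening a partition into classes can only merge classes, and by uniform
   continuity of phi the number of its points of persistence larger than eps is
   bounded uniformly in r. Hence both sums in rhobar are N times those of one
   period up to O(1), and the quotients differ by O(1/N). If the one-period
   sums vanish, then M - min phi <= eps (the bar (min phi, M) lies in the
   diagram), and then both functionals are zero. *)

Require Import Defs.
From HB Require Import structures.
From mathcomp Require Import all_boot all_order all_algebra.
From mathcomp Require Import all_classical all_reals all_analysis.
From mathcomp Require Import freeg ring lra zify.

Set Implicit Arguments.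
Unset Strict Implicit.
Unset Printing Implicit Defensive.

Import Order.TTheory GRing.Theory Num.Theory.
Import numFieldNormedType.Exports.

Local Open Scope classical_set_scope.
Local Open Scope ring_scope.

(** * Transversals of partial equivalence relations *)

Section Transversal.
Context {T : choiceType}.
Implicit Types (E : rel T) (A B : set T) (S : seq T).

Definition independent E A S :=
  {in S, forall x, A x} /\ pairwise (fun x y => ~~ E x y) S.

(** One representative for each [E]-class that meets [A]. Later [A] is a sublevel set at level [s]
    and [E] is connection at a level [t > s]. *)
Definition transversal E A S :=
  independent E A S /\ forall x, A x -> has (E x) S.

(** Independent of the transversal when [E] is symmetric and transitive, by [ncls_eq]. The default
    [[::]] gives 0 if there is no transversal. *)
Definition ncls E A : nat := size (xget [::] (transversal E A)).

Definition bounded_classes E A :=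
  exists n, forall S, independent E A S -> (size S <= n)%N.

(** Pigeonhole: send [x] in [S] to the index of the first element of [S'] related to it. Equal
    indices would relate two elements of [S]. *)
Lemma independent_size E A S S' : symmetric E -> transitive E ->
  independent E A S -> {in S, forall x, has (E x) S'} -> (size S <= size S')%N.
Proof.
move=> Esym Etr [_ SE] SS'.
rewrite -(size_map (fun x => find (E x) S')) -[leqRHS](size_iota 0).
apply: uniq_leq_size => [|_ /mapP[x /SS' xS' ->]]; last first.
  by rewrite mem_iota add0n -has_find.
rewrite uniq_pairwise pairwise_map.
apply: (sub_in_pairwise (P := mem S)) SE; last exact/allP.
move=> x y xS yS /=; apply: contraNN => /eqP xy.
have x0 := x.
have /(nth_find x0) Ex := SS' _ xS; have /(nth_find x0) := SS' _ yS.
by rewrite -xy Esym; apply: Etr Ex.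
Qed.

Lemma ncls_eq E A S : symmetric E -> transitive E ->
  transversal E A S -> ncls E A = size S.
Proof.
move=> Esym Etr.
have le U U' : transversal E A U -> transversal E A U' -> (size U <= size U')%N.
  by move=> UA U'A; apply: (independent_size Esym Etr UA.1) => x /UA.1.1/U'A.2.
move=> SA; rewrite /ncls; case: xgetP => [S' _ S'A|/(_ S)//].
by apply/eqP; rewrite eqn_leq !le.
Qed.

(** Greedy: append an element of [A] related to nothing listed so far. The bound on independent
    lists stops the process. *)
Lemma independent_extend E A S : symmetric E ->
  {in A, forall x, E x x} -> bounded_classes E A ->
  independent E A S -> exists S', transversal E A (S ++ S').
Proof.
move=> Esym Erefl [n An].
have [k] := ubnP (n.+1 - size S)%N.
elim: k S => // k IHk S; rewrite ltnS => Sk SA.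
have [/existsNP[x]|/contrapT ST] :=
  pselect (~ forall x, A x -> has (E x) S); last first.
  by exists [::]; rewrite cats0.
move=> /not_implyP[Ax /negP/hasPn xS].
have SxA : independent E A (rcons S x).
  split=> [y|].
    by rewrite mem_rcons inE => /orP[/eqP->//|]; apply: SA.1.
  rewrite pairwise_rcons SA.2 andbT; apply/allP => y /xS.
  by rewrite /= Esym.
have [|S' S'A] := IHk _ _ SxA.
  have := An _ SxA; rewrite size_rcons => /ltnW le_Sn.
  by rewrite subSS -subSn.
by exists (x :: S'); rewrite -cat_rcons.
Qed.

Lemma transversal_exists E A : symmetric E ->
  {in A, forall x, E x x} -> bounded_classes E A -> exists S, transversal E A S.
Proof. by move=> Esym Erefl bA; apply: (@independent_extend _ _ [::]). Qed.

(* A class at the coarser level that avoids [A] contains a class at the finer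
   level that avoids [A], so [ncls E B - ncls E A] can only decrease when [E]
   is coarsened. *)
Lemma ncls_box E1 E2 A B : symmetric E1 -> transitive E1 ->
  symmetric E2 -> transitive E2 -> (forall x y, E1 x y -> E2 x y) ->
  A `<=` B -> {in B, forall x, E1 x x} -> bounded_classes E1 B ->
  (ncls E1 A + ncls E2 B <= ncls E1 B + ncls E2 A)%N.
Proof.
move=> s1 t1 s2 t2 E12 AB r1 b1.
have r2 : {in B, forall x, E2 x x} by move=> x /r1 /E12.
have rA (E : rel T) : {in B, forall x, E x x} -> {in A, forall x, E x x}.
  by move=> r x /set_mem/AB/mem_set/r.
have b2 : bounded_classes E2 B.
  have [n bn] := b1; exists n => S [SB Sp]; apply: bn; split=> //.
  by apply: sub_pairwise Sp => x y; apply/contraNN/E12.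
have bA E : bounded_classes E B -> bounded_classes E A.
  by case=> n bn; exists n => S [SA Sp]; apply: bn; split=> // x /SA/AB.
have [SA SAt] := transversal_exists s1 (rA _ r1) (bA _ b1).
have [UA UAt] := transversal_exists s2 (rA _ r2) (bA _ b2).
have UAB : independent E2 B UA by split; [move=> x /UAt.1.1/AB|exact: UAt.1.2].
(* [H] represents the [E2]-classes of [B] that avoid [A]. Once [size UA] cancels, it remains to see
   that [SA ++ H] is [E1]-independent. *)
have [H Ht] := independent_extend s2 r2 b2 UAB.
have [SB SBt] := transversal_exists s1 r1 b1.
rewrite (ncls_eq s1 t1 SAt) (ncls_eq s2 t2 UAt) (ncls_eq s2 t2 Ht).
rewrite (ncls_eq s1 t1 SBt) size_cat [(_ + size H)%N]addnC addnA leq_add2r.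
rewrite -size_cat; apply: (independent_size (A := B)) => //; last first.
  move=> x xS; apply: SBt.2; move: xS.
  rewrite mem_cat => /orP[/SAt.1.1/AB//|xH].
  by apply: Ht.1.1; rewrite mem_cat xH orbT.
have Hi := Ht.1.2; rewrite pairwise_cat in Hi.
have /and3P[/allrelP UH _ HH] := Hi.
split=> [x|].
  rewrite mem_cat => /orP[/SAt.1.1/AB//|xH].
  by apply: Ht.1.1; rewrite mem_cat xH orbT.
rewrite pairwise_cat SAt.1.2 /=; apply/andP; split; last first.
  by apply: sub_pairwise HH => x y; apply/contraNN/E12.
(* If [x] in [SA] were related to [y] in [H], then [y] would share its [E2]-class with a member [u]
   of [UA]. *)
apply/allrelP => x y xS yH; apply/negP => /E12 xy.
have /hasP[u uU xu] := UAt.2 _ (SAt.1.1 _ xS).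
by have /negP := UH _ _ uU yH; apply; apply: t2 xy; rewrite s2.
Qed.

Lemma ncls_le E A B : symmetric E -> transitive E -> A `<=` B ->
  {in B, forall x, E x x} -> bounded_classes E B -> (ncls E A <= ncls E B)%N.
Proof.
move=> Esym Etr AB Erefl [n bn].
have [||S SA] := @transversal_exists E A Esym.
- by move=> x /set_mem/AB/mem_set/Erefl.
- by exists n => S [SA Sp]; apply: bn; split=> // x /SA/AB.
have [|S' SB] := transversal_exists Esym Erefl; first by exists n.
rewrite (ncls_eq Esym Etr SA) (ncls_eq Esym Etr SB).
by apply: (independent_size Esym Etr SA.1) => x /SA.1.1/AB/SB.2.
Qed.

Lemma transversalU E A B S S' : symmetric E ->
  (forall x y, A x -> B y -> ~~ E x y) ->
  transversal E A S -> transversal E B S' -> transversal E (A `|` B) (S ++ S').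
Proof.
move=> Esym AB [[SA Sp] St] [[SA' Sp'] St']; split; first split.
- by move=> x; rewrite mem_cat => /orP[/SA|/SA']; [left|right].
- rewrite pairwise_cat Sp Sp' !andbT; apply/allrelP => x y /SA + /SA'.
  exact: AB.
- by move=> x; rewrite has_cat => -[/St->//|/St'->]; rewrite orbT.
Qed.

Lemma transversal_map E A S (f : T -> T) :
  (forall x y, E (f x) (f y) = E x y) ->
  transversal E A S -> transversal E (f @` A) (map f S).
Proof.
move=> Ef [[SA Sp] St]; split; first split.
- by move=> _ /mapP[x /SA Ax ->]; exists x.
- by rewrite pairwise_map; apply: sub_pairwise Sp => x y /=; rewrite Ef.
- move=> _ [x /St/hasP[y yS xy] <-]; apply/hasP; exists (f y).
    exact: map_f.
  by rewrite Ef.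
Qed.

Lemma bounded_classesU E A B :
  bounded_classes E A -> bounded_classes E B -> bounded_classes E (A `|` B).
Proof.
move=> [n An] [m Bm]; exists (n + m)%N => S [SAB Sp].
rewrite -(count_predC (fun x => `[< A x >])) leq_add// -size_filter.
  apply: An; split; last exact: pairwise_filter.
  by move=> x; rewrite mem_filter => /andP[/asboolP].
apply: Bm; split; last exact: pairwise_filter.
by move=> x; rewrite mem_filter => /andP[/asboolPn + /SAB[]].
Qed.

End Transversal.

(** * Components of sublevel sets *)

Section Joined.
Context {R : realType} (phi : R -> R).
Implicit Types (s t x y z u v : R) (S : seq R).

(** Lying in one component of the sublevel set of the whole line. It is reflexive only where [phi]
    is at most [t], hence a partial equivalence relation. *)
Definition joined t : rel R := fun x y =>
  `[< forall z, (x <= z <= y) || (y <= z <= x) -> phi z <= t >].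

Lemma joined_sym t : symmetric (joined t).
Proof.
by move=> x y; apply/asboolP/asboolP => + z => /(_ z); rewrite orbC.
Qed.

Lemma joined_trans t : transitive (joined t).
Proof.
move=> y x z /asboolP xy /asboolP yz; apply/asboolP => w /orP[]/andP[h1 h2].
  by have [wy|/ltW wy] := leP w y;
    [apply: xy|apply: yz]; rewrite ?h1 ?h2 wy ?orbT.
by have [wy|/ltW wy] := leP w y;
  [apply: yz|apply: xy]; rewrite ?h1 ?h2 wy ?orbT.
Qed.

Lemma joined_refl t x : phi x <= t -> joined t x x.
Proof.
by move=> xt; apply/asboolP => z; rewrite orbb => /le_anti <-.
Qed.

Lemma joined_le s t x y : s <= t -> joined s x y -> joined t x y.
Proof. by move=> st /asboolP h; apply/asboolP => z /h /le_trans; apply. Qed.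

Lemma joinedN t x y w : x <= w <= y -> t < phi w -> ~~ joined t x y.
Proof.
move=> xwy tw; apply/negP => /asboolP/(_ w); rewrite xwy => /(_ isT).
by rewrite leNgt tw.
Qed.

Lemma sublevelU A B s :
  sublevel phi (A `|` B) s = sublevel phi A s `|` sublevel phi B s.
Proof. exact: setIUl. Qed.

(** Cut [[u, v]] into cells of length [d]. Between two points of [S] in one cell everything is
    within [d] of the first, so they would be joined at level [t]. *)
Lemma independent_sublevel_size s t d u v S : 0 < d ->
  (forall x y, `|x - y| < d -> phi x <= s -> phi y <= t) ->
  independent (joined t) (sublevel phi `[u, v] s) S ->
  (size S <= (Num.truncn ((v - u) / d)).+1)%N.
Proof.
move=> d0 mod_d [SA Sp].
pose f x := Num.truncn ((x - u) / d).
have fP x : x \in S -> [/\ u <= x <= v, phi x <= s &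
    (f x)%:R * d <= x - u < (f x).+1%:R * d].
  move=> /SA[/=]; rewrite in_itv /= => xuv xs; split=> //.
  rewrite -ler_pdivlMr// -ltr_pdivrMr//; apply: Num.Theory.truncn_itv.
  by rewrite divr_ge0 ?subr_ge0 ?(ltW d0)//; case/andP: xuv.
rewrite -(size_map f) -[leqRHS](size_iota 0).
apply: uniq_leq_size => [|_ /mapP[x /fP[xuv _ _] ->]]; last first.
  rewrite mem_iota add0n ltnS /=; apply: Num.Theory.le_truncn.
  by rewrite ler_pM2r ?invr_gt0// lerD2r; case/andP: xuv.
rewrite uniq_pairwise pairwise_map.
apply: (sub_in_pairwise (P := mem S)) Sp; last exact/allP.
move=> x y /fP[_ xs /andP[x1 x2]] /fP[_ ys /andP[y1 y2]] /=.
apply: contraNN => /eqP xy; apply/asboolP => z xzy.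
apply: (mod_d x) xs; move: x1 x2 y1 y2; rewrite -xy -natr1 mulrDl mul1r.
move: ((f x)%:R * d) => q ? ? ? ?.
by rewrite ltr_norml; case/orP: xzy => /andP[? ?]; apply/andP; split; lra.
Qed.

End Joined.

(** * Uniform continuity and minimum of a periodic function *)

Section Periodic.
Context {R : realType} (phi : R -> R).
Hypotheses (phi_cont : continuous phi) (phi_per : periodic phi 1).

Lemma periodic_int (x : R) (m : int) : phi (x + m%:~R) = phi x.
Proof.
case: m => n; first by rewrite -pmulrn periodicn.
by rewrite NegzE mulrNz -pmulrn -(periodicn phi_per n.+1 (x - _)) subrK.
Qed.

(** Compactness of the unit interval gives one [d] for all [x] in it. An integer translation brings
    any other [x] there, together with [y]. *)
Lemma periodic_unif_continuous (eta : R) : 0 < eta ->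
  exists2 d, 0 < d & forall x y, `|x - y| < d -> `|phi x - phi y| < eta.
Proof.
move=> eta0.
have /compact_near_coveringP := @segment_compact R 0 1.
move=> /(_ _ (0^'+)
  (fun d x => forall y, `|x - y| < d -> `|phi x - phi y| < eta)).
case=> [x _|d /= d0 near_d].
  have /cvgrPdist_lt/(_ (eta / 2)) : phi y @[y --> x] --> phi x := @phi_cont x.
  rewrite divr_gt0// => /(_ isT); rewrite near_nbhs => /nbhs_ballP[e /= e0 he].
  exists (ball x (e / 2), [set d | d < e / 2]); rewrite /=; first split.
  - by apply: nbhsx_ballx; rewrite divr_gt0.
  - by apply: nbhs_right_lt; rewrite divr_gt0.
  move=> [x' d] [/= xx' de] y x'y.
  have h1 := he x'; have h2 := he y.
  have {}h1 : `|phi x - phi x'| < eta / 2.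
    by apply: h1; rewrite /ball/=; move: xx'; rewrite /ball/=; lra.
  have {}h2 : `|phi x - phi y| < eta / 2.
    apply: h2; rewrite /ball/=; rewrite -(subrKA x').
    by apply: le_lt_trans (ler_normD _ _) _; move: xx'; rewrite /ball/=; lra.
  rewrite -(subrKA (phi x)); apply: le_lt_trans (ler_normD _ _) _.
  by rewrite (distrC (phi x')); lra.
have d2 : 0 < d / 2 by rewrite divr_gt0.
exists (d / 2) => // x y xy.
pose m : int := - Num.floor x.
rewrite -(periodic_int x m) -(periodic_int y m).
apply: (near_d (d / 2)) => //=.
- rewrite sub0r normrN gtr0_norm//; lra.
- rewrite in_itv /= /m mulrNz subr_ge0 Num.Theory.floor_le /=.
  by have := Num.Theory.floorD1_gt x; rewrite intrD; lra.
- by rewrite [X in `|X|](_ : _ = x - y)//; ring.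
Qed.

Lemma bounded_classes_sublevel (s t u v : R) : s < t ->
  bounded_classes (joined phi t) (sublevel phi `[u, v] s).
Proof.
rewrite -subr_gt0 => /periodic_unif_continuous[d d0 hd].
exists (Num.truncn ((v - u) / d)).+1 => S.
apply: independent_sublevel_size => // x y.
by move=> /hd; rewrite ltr_norml => /andP[? ?] ?; lra.
Qed.

Lemma periodic_min (c : R) :
  exists2 x0, c <= x0 <= c + 1 & forall x, phi x0 <= phi x.
Proof.
have [|x0 x0c hx0] :=
  @EVT_min R phi c (c + 1) _ (continuous_subspaceT phi_cont).
  by rewrite lerDl.
exists x0; first by rewrite in_itv /= in x0c.
move=> x; rewrite -(periodic_int x (- Num.floor (x - c))).
apply: hx0; rewrite in_itv /= mulrNz.
have := Num.Theory.floor_itv (x - c); rewrite intrD => /andP[? ?].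
by apply/andP; split; lra.
Qed.

End Periodic.

(** * Splitting the classes at the maximum points *)

Section Decomposition.
Context {R : realType} (phi : R -> R) (c : R).
Hypotheses (phi_cont : continuous phi) (phi_per : periodic phi 1).

(* As [phi] exceeds [t] at every [c + i], the classes of a union of pieces with
   endpoints of this form are the classes of the pieces. *)
Lemma periods_transversal s t (N : nat) S : t < phi c -> s < t ->
  transversal (joined phi t) (sublevel phi `[c, c + 1] s) S ->
  exists2 S', transversal (joined phi t) (sublevel phi `[c, c + N%:R] s) S' &
    size S' = (N * size S)%N.
Proof.
move=> tc st ST; elim: N => [|N [S' S'T S'E]].
  (* For no period the interval is the single point [c], where [phi] exceeds [s]. *)
  exists [::] => //; split; first by split.
  move=> x [/=]; rewrite addr0 in_itv /= => /le_anti <-.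
  by rewrite leNgt (lt_trans st).
exists (S' ++ map (+%R N%:R) S); last first.
  by rewrite size_cat size_map S'E mulSn addnC.
have phiN x : phi (N%:R + x) = phi x by rewrite addrC periodicn.
have -> : sublevel phi `[c, c + N.+1%:R] s = sublevel phi `[c, c + N%:R] s `|`
    [set N%:R + x | x in sublevel phi `[c, c + 1] s].
  rewrite -natr1; have N0 : 0 <= N%:R :> R by [].
  apply/seteqP; split=> [x [/=]|x [[/=]|[y [/=]]]];
    rewrite !in_itv /= => /andP[h1 h2].
  - move=> xs; have [xN|Nx] := leP x (c + N%:R); [left|right].
      by split=> //=; rewrite in_itv /= h1.
    exists (x - N%:R); last by rewrite addrC subrK.
    split; first by rewrite /= in_itv /=; apply/andP; split; lra.
    by rewrite /= -(phiN (x - _)) addrC subrK.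
  - by move=> xs; split=> //=; rewrite in_itv /=; apply/andP; split; lra.
  - move=> ys <-; split; last by rewrite /= phiN.
    by rewrite /= in_itv /=; apply/andP; split; lra.
apply: transversalU S'T _ => [|x _ [/= + _] [y [/= + _] <-]|].
- exact: joined_sym.
- rewrite !in_itv /= => /andP[? ?] /andP[? ?].
  (* The new period meets the old ones only at [c + N], where [phi] exceeds [t]. *)
  apply: (@joinedN _ _ _ _ _ (N%:R + c)); rewrite ?phiN//.
  by apply/andP; split; lra.
- apply: transversal_map ST => x y.
  apply/asboolP/asboolP => h z xzy.
    by rewrite -phiN; apply: h; rewrite !lerD2l.
  rewrite -[z](subrKC N%:R) phiN; apply: h.
  by case/orP: xzy => /andP[? ?]; apply/orP; [left|right];
    apply/andP; split; lra.
Qed.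

(** The whole periods are separated from the two end pieces by [c] and [c + N], where [phi] exceeds
    [t], so transversals concatenate. *)
Lemma ncls_decomposition s t (N : nat) (r : R) : 0 <= c -> c + N%:R <= r ->
  t < phi c -> s < t ->
  ncls (joined phi t) (sublevel phi `[0, r] s) =
  (N * ncls (joined phi t) (sublevel phi `[c, (c + 1)%R] s) +
   ncls (joined phi t) (sublevel phi (`[0%R, c] `|` `[(c + N%:R)%R, r]) s))%N.
Proof.
move=> c0 cNr tc st.
have ex A : bounded_classes (joined phi t) (sublevel phi A s) ->
    exists S, transversal (joined phi t) (sublevel phi A s) S.
  apply: transversal_exists; first exact: joined_sym.
  by move=> x /set_mem[_ /= xs]; apply/joined_refl/(le_trans xs)/ltW.
have bd u v := bounded_classes_sublevel phi_cont phi_per u v st.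
have [S ST] := ex _ (bd c (c + 1)).
have [|J JT] := ex (`[0, c] `|` `[c + N%:R, r]).
  by rewrite sublevelU; apply: bounded_classesU; apply: bd.
have [S' S'T S'E] := periods_transversal N tc st ST.
have phiN : phi (c + N%:R) = phi c by rewrite periodicn.
have := transversalU (joined_sym phi t) _ S'T JT.
rewrite -sublevelU.
have -> : (`[c, c + N%:R] `|` (`[0, c] `|` `[c + N%:R, r]) = `[0, r])%classic.
  have N0 : 0 <= N%:R :> R by [].
  apply/seteqP; split=> x /=; rewrite !in_itv /=.
    by case=> [|[]] /andP[? ?]; apply/andP; split; lra.
  case/andP=> x0 xr; have [xc|/ltW cx] := leP x c.
    by right; left; rewrite x0.
  have [xN|/ltW Nx] := leP x (c + N%:R); first by left; rewrite cx.
  by right; right; rewrite Nx.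
have E := ncls_eq (joined_sym phi t) (@joined_trans _ phi t).
rewrite (E _ _ ST) (E _ _ JT) -S'E -size_cat => /(_ _)/E; apply.
move=> x y [/=]; rewrite in_itv /= => /andP[cx xN] _ [/= + _].
case; rewrite in_itv /= => /andP[? ?].
  by rewrite joined_sym; apply: (@joinedN _ _ _ _ _ c) => //; apply/andP; split.
by apply: (@joinedN _ _ _ _ _ (c + N%:R)); rewrite ?phiN//; apply/andP; split.
Qed.

End Decomposition.

(** * Ranks of the persistence module *)

Section LinearRank.
Context {F : fieldType} {U V : lmodType F}.

(** If [m < n], the coefficient matrix has dependent rows; a nonzero vector killing it from the left
    is a linear relation among the [e i]. *)
Lemma lin_indep_leq n m (e : 'I_n -> V) (e' : 'I_m -> V) : lin_indep e ->
  (forall i, exists a : 'I_m -> F, e i = \sum_j a j *: e' j) -> (n <= m)%N.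
Proof.
move=> free_e /choice[a ea]; rewrite leqNgt; apply/negP => lt_mn.
pose A := \matrix_(i < n, j < m) a i j.
have : ~~ row_free A.
  by rewrite /row_free neq_ltn (leq_ltn_trans (rank_leq_col A)).
rewrite -kermx_eq0 => /rowV0Pn[v /sub_kermxP vA v0].
case/negP: v0; apply/eqP/rowP => i; rewrite mxE.
apply: (free_e (v 0)); under eq_bigr do rewrite ea scaler_sumr.
rewrite exchange_big big1// => j _.
under eq_bigr do rewrite scalerA.
rewrite -scaler_suml; have /rowP/(_ j) := vA; rewrite !mxE => vAj.
rewrite (_ : \sum_i _ = 0) ?scale0r// -[RHS]vAj.
by apply: eq_bigr => k _; rewrite mxE.
Qed.

Lemma rank_eq (f : U -> V) n : has_rank f n -> rank f = n.
Proof.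
have le k m : has_rank f k -> has_rank f m -> (k <= m)%N.
  move=> [e [free_e fe]] [e' [_ fe']]; apply: (lin_indep_leq free_e) => i.
  suff [a _ <-] : [set \sum_j a j *: e' j | a in [set: 'I_m -> F]] (e i).
    by exists a.
  rewrite -fe' fe; exists (fun j => (i == j)%:R) => //.
  rewrite (bigD1 i)//= eqxx scale1r big1 ?addr0// => j.
  by rewrite eq_sym => /negPf->; rewrite scale0r.
move=> fn; rewrite /rank; case: xgetP => [m _ fm|/(_ n)//].
by apply/eqP; rewrite eqn_leq !le.
Qed.

Lemma rank_zero : rank (fun=> 0 : V) (U := U) = 0%N.
Proof.
apply: rank_eq; exists (fun=> 0); split=> [a _ []//|].
apply/seteqP; split=> v [x _ <-]; last by exists 0; rewrite // big_ord0.
by exists (fun=> 0) => //; rewrite big_ord0.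
Qed.

End LinearRank.

(** * Paths in sublevel sets *)

Section SublevelHomology.
Context {R : realType} {F : fieldType} (h : R -> R) (X : set R).

Lemma pm_rankE s t (st : s < t) : t < hmax h X ->
  pm_rank F h X st = rank (@H0_map R F _ _ (subfun (@sublevelS _ h X _ _ st))).
Proof.
move=> tM; have sM := lt_trans st tM; rewrite /pm_rank /pm_map /pm_space.
(* The types depend on the two comparisons, so these are generalized before being decided. *)
by move: (s < hmax h X) (t < hmax h X) sM tM => [] [].
Qed.

Lemma pm_rank_hmax s t (st : s < t) : hmax h X <= t -> pm_rank F h X st = 0%N.
Proof.
rewrite leNgt => /negPf tM; rewrite /pm_rank /pm_map /pm_space.
by move: (s < hmax h X) (t < hmax h X) tM => [] [] // _; apply: rank_zero.
Qed.

(** By the intermediate value theorem a path takes every value between its endpoints, and all its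
    values lie in the sublevel set. *)
Lemma simplex1_joined t (u : simplex1 R (sublevel h X t)) :
  joined h t (\val (u (itv1 R))) (\val (u (itv0 R))).
Proof.
pose g : @unit_itv R -> R := fun x => \val (u x).
have cg : continuous g.
  move=> x; apply: (@continuous_comp _ _ _ u set_val); first exact: cts_fun.
  exact: initial_continuous.
have {}cg : {within @unit_itv R, continuous (valL_ 0 g)}.
  exact/subspace_valL_continuousP'.
have gE x : valL_ 0 g (\val x) = g x by rewrite -[in RHS](valLK 0 g).
have := @IVT R (valL_ 0 g) 0 1 _ ler01 cg.
rewrite (gE (itv0 R)) (gE (itv1 R)) => ivt.
apply/asboolP => z; rewrite -/(g (itv0 R)) -/(g (itv1 R)) => hz.
have /ivt[y y01 <-] : Num.min (g (itv0 R)) (g (itv1 R)) <= z <=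
    Num.max (g (itv0 R)) (g (itv1 R)).
  by rewrite ge_min le_max; case/orP: hz => /andP[-> ->]; rewrite ?orbT.
have y01' : y \in @unit_itv R by apply/mem_set.
rewrite (gE (SigSub y01')) /g.
by have /set_mem[_] := valP (u (SigSub y01')).
Qed.

(** The straight path from [y] to [x] stays in [X], an interval, and in the sublevel set, by
    joinedness. *)
Lemma joined_boundary t (x y : sublevel h X t) : is_interval X ->
  joined h t (\val x) (\val y) ->
  exists u, boundary1 R F (sublevel h X t) u = << x >> - << y >>.
Proof.
move=> itvX /asboolP xy.
pose g (r : @unit_itv R) : R := \val y + \val r * (\val x - \val y).
have gX r : g r \in sublevel h X t.
  have [/andP[r0 r1]] : 0 <= \val r <= 1.
    by have /set_mem := valP r; rewrite /unit_itv /= in_itv.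
  have [Xx _] := set_mem (valP x); have [Xy _] := set_mem (valP y).
  apply/mem_set; have [le_xy|/ltW le_yx] := leP (\val x) (\val y).
  - have gxy : \val x <= g r <= \val y by rewrite /g; apply/andP; split; nra.
    split; first exact: itvX gxy.
    by apply: xy; rewrite gxy.
  - have gxy : \val y <= g r <= \val x by rewrite /g; apply/andP; split; nra.
    split; first exact: itvX gxy.
    by apply: xy; rewrite gxy orbT.
pose G r : sublevel h X t := SigSub (gX r).
have cG : continuous G.
  suff cg : continuous g.
    by refine (@continuous_comp_initial _ _ _ set_val G cg).
  move=> r.
  apply: (@continuousD R R (@unit_itv R) (cst (\val y)) (fun r => \val r * _)).
    exact: (@cst_continuous (@unit_itv R)).
  apply: (@continuousM R (@unit_itv R) set_val (cst _)).
    exact: initial_continuous.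
  exact: (@cst_continuous (@unit_itv R)).
exists << (HB.pack_for (simplex1 R (sublevel h X t)) G
    (isContinuous.Build _ _ _ cG) : {classic simplex1 R (sublevel h X t)}) >>.
rewrite /boundary1 /= liftU scale1r; congr (<< _ >> - << _ >>).
  by apply: val_inj; rewrite /= /g /= mul1r subrKC.
by apply: val_inj; rewrite /= /g /= mul0r addr0.
Qed.

End SublevelHomology.

(** * Ranks as numbers of classes *)

Section RankTransversal.
Context {R : realType} {F : fieldType} (h : R -> R) (X : set R).

Lemma freeg_ind_unit (K : choiceType) (P : {freeg K / F} -> Prop) :
  P 0 -> (forall a x D, P D -> P (a *: << x >> + D)) -> forall D, P D.
Proof.
move=> P0 PD D; rewrite -[D]freeg_sumE; elim: (dom D) => [|x r IH].
  by rewrite big_nil.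
rewrite big_cons [<< _ *g _ >>](_ : _ = coeff x D *: << x >>); first exact: PD.
by apply/eqP/freeg_eqP => y; rewrite coeffZ !coeffU mul1r.
Qed.

Lemma coker_proj_lincomb (U V : lmodType F) (f : {linear U -> V}) n
    (a : 'I_n -> F) (z : 'I_n -> V) :
  coker_proj f (\sum_i a i *: z i) = \sum_i a i *: coker_proj f (z i).
Proof.
rewrite (big_morph (coker_proj f) (@coker_projD _ _ _ f) (id1 := 0));
  last first.
  by apply/(addrI (coker_proj f 0)); rewrite -coker_projD !addr0.
by apply: eq_bigr => i _; rewrite -coker_scale_proj.
Qed.

Lemma subfun_continuous (A B : set R) (AB : A `<=` B) :
  continuous (subfun AB : A -> B).
Proof.
refine (@continuous_comp_initial _ _ _ set_val _ _).
exact: initial_continuous.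
Qed.

Lemma coker_proj_joined t (x y : sublevel h X t) : is_interval X ->
  joined h t (\val x) (\val y) ->
  coker_proj (boundary1 R F (sublevel h X t)) << x >> =
  coker_proj (boundary1 R F (sublevel h X t)) << y >>.
Proof. by move=> itvX xy; apply/coker_projP/joined_boundary. Qed.

(** Summing coefficients over the class of [y] kills boundaries, as the endpoints of a simplex lie
    in one class. These functionals detect independence in homology. *)
Lemma class_indicator_boundary t y u :
  fglift (fun x : sublevel h X t => (joined h t (\val x) y)%:R : F^o)
    (boundary1 R F (sublevel h X t) u) = 0.
Proof.
elim/freeg_ind_unit: u => [|a s u IH]; first by rewrite !raddf0.
rewrite 2!linearP /= IH addr0.
rewrite /boundary1 /= liftU scale1r raddfB /= !liftU !scale1r.
set s1 := joined _ _ _ _; set s0 := joined _ _ _ _.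
suff -> : s1 = s0 by rewrite subrr scaler0.
have s10 := simplex1_joined (s : simplex1 R (sublevel h X t)).
apply/idP/idP; apply: joined_trans => //.
by rewrite joined_sym.
Qed.

(** The points of [S] give a basis of the image: class indicators separate them, and every point of
    the lower sublevel set is joined at level [t] to one of them. *)
Lemma has_rank_transversal s t (st : s < t) (S : seq R) : is_interval X ->
  transversal (joined h t) (sublevel h X s) S ->
  has_rank (@H0_map R F _ _ (subfun (@sublevelS _ h X _ _ st))) (size S).
Proof.
move=> itvX [[SX Sp] St]; set f := subfun _.
have cf : continuous f by exact: subfun_continuous.
set d := boundary1 R F (sublevel h X t).
have SX' (i : 'I_(size S)) : tnth (in_tuple S) i \in sublevel h X s.
  by apply/mem_set/SX/mem_tnth.
pose q i : sublevel h X s := SigSub (SX' i).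
pose e i := coker_proj d << f (q i) >>.
exists e; split.
  move=> a; rewrite -coker_proj_lincomb => ae i.
  have /coker_projP[u] :
      coker_proj d (\sum_j a j *: << f (q j) >>) = coker_proj d 0.
    rewrite ae; apply/(addrI (coker_proj d 0)).
    by rewrite -coker_projD !addr0.
  rewrite subr0.
  (* Pairing with the indicator of the class of [q i] isolates the coefficient [a i]. *)
  move=> /(congr1 (fglift (fun x : sublevel h X t =>
    (joined h t (\val x) (\val (q i)))%:R : F^o))).
  rewrite class_indicator_boundary raddf_sum (bigD1 i)//= big1 ?addr0.
    rewrite linearZ /= liftU scale1r joined_refl.
      by rewrite /GRing.scale/= mulr1.
    by have [] := set_mem (valP (f (q i))).
  move=> j ji; rewrite linearZ /= liftU scale1r.
  suff /negPf-> : ~~ joined h t (\val (q j)) (\val (q i)) by rewrite scaler0.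
  rewrite /= !(tnth_nth 0) /=; move/(pairwiseP 0): Sp => Sp.
  have := ji; rewrite -val_eqE /= neq_ltn => /orP[]/Sp; rewrite !inE !ltn_ord.
    by apply.
  by rewrite joined_sym; apply.
have eq x : exists i, coker_proj d << f x >> = e i.
  have /hasP[y yS xy] := St _ (set_mem (valP x)).
  have /seq_tnthP := yS; case=> i yi; exists i.
  by apply: coker_proj_joined => //=; rewrite yi in xy.
apply/seteqP; split=> [_ [z _ <-]|_ [a _ <-]].
  have [{}z <-] := coker_proj_surj (z : coker (boundary1 R F (sublevel h X s))).
  rewrite H0_map_proj//; elim/freeg_ind_unit: z => [|b x z [a _ IH]].
    exists (fun=> 0) => //; rewrite raddf0 big1; last first.
      by move=> i _; rewrite scale0r.
    by apply/(addrI (coker_proj d 0)); rewrite -coker_projD !addr0.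
  have [i xi] := eq x.
  exists (fun j => b * (i == j)%:R + a j) => //.
  rewrite linearP /= coker_projD -IH liftU scale1r.
  under eq_bigr do rewrite scalerDl -scalerA.
  rewrite big_split /= (bigD1 i)//= eqxx scale1r big1 ?addr0.
    congr (_ + _); rewrite -xi; exact: coker_scale_proj.
  by move=> j; rewrite eq_sym => /negPf->; rewrite scale0r scaler0.
exists (coker_proj _ (\sum_i a i *: << q i >>)) => //.
rewrite H0_map_proj// linear_sum -coker_proj_lincomb; congr (coker_proj _ _).
by apply: eq_bigr => i _; rewrite linearZ /= liftU scale1r.
Qed.

Lemma pm_rank_transversal s t (st : s < t) (S : seq R) : is_interval X ->
  t < hmax h X -> transversal (joined h t) (sublevel h X s) S ->
  pm_rank F h X st = size S.
Proof.
by move=> itvX tM ST; rewrite pm_rankE//; apply/rank_eq/has_rank_transversal.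
Qed.

End RankTransversal.

(** * Rank decomposition into periods and end pieces *)

Section Ranks.
Context {R : realType} (F : fieldType) (phi : R -> R) (c : R).
Hypotheses (phi_cont : continuous phi) (phi_per : periodic phi 1).
Hypotheses (c_max : forall x, phi x <= phi c).

Lemma hmax_eq (X : set R) : X c -> hmax phi X = phi c.
Proof.
move=> Xc; apply/le_anti/andP; split.
  by apply: ge_sup; [exists (phi c), c|move=> _ [x _ <-]].
by apply: ub_le_sup; [exists (phi c) => _ [x _ <-]|exists c].
Qed.

Lemma pm_rank_ncls u v s t (st : s < t) : u <= c <= v -> t < phi c ->
  pm_rank F phi `[u, v] st = ncls (joined phi t) (sublevel phi `[u, v] s).
Proof.
move=> uv tc.
have [|||S ST] := @transversal_exists _ (joined phi t) (sublevel phi `[u, v] s).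
- exact: joined_sym.
- by move=> x /set_mem[_ /= xs]; apply/joined_refl/(le_trans xs)/ltW.
- exact: bounded_classes_sublevel.
rewrite (ncls_eq (joined_sym _ _) (@joined_trans _ _ _) ST).
by apply: pm_rank_transversal => //;
  [exact: interval_is_interval|rewrite hmax_eq].
Qed.

Lemma pm_rank_ge_max u v s t (st : s < t) : u <= c <= v -> phi c <= t ->
  pm_rank F phi `[u, v] st = 0%N.
Proof. by move=> uv ct; apply: pm_rank_hmax; rewrite hmax_eq. Qed.

Lemma pm_rank_lt_min u v s t (st : s < t) : u <= c <= v ->
  (forall x, s < phi x) -> pm_rank F phi `[u, v] st = 0%N.
Proof.
move=> uv sphi; have [ct|tc] := leP (phi c) t; first exact: pm_rank_ge_max.
rewrite pm_rank_ncls// (@ncls_eq _ _ _ [::])//; first exact: joined_sym.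
  exact: joined_trans.
by split=> // x [_ /=]; rewrite leNgt sphi.
Qed.

Lemma pm_rank_gt0 u v s t (st : s < t) x : u <= c <= v -> t < phi c ->
  u <= x <= v -> phi x <= s -> (0 < pm_rank F phi `[u, v] st)%N.
Proof.
move=> uv tc xuv xs; rewrite pm_rank_ncls//.
have [|||S ST] := @transversal_exists _ (joined phi t) (sublevel phi `[u, v] s).
- exact: joined_sym.
- by move=> y /set_mem[_ /= ys]; apply/joined_refl/(le_trans ys)/ltW.
- exact: bounded_classes_sublevel.
rewrite (ncls_eq (joined_sym _ _) (@joined_trans _ _ _) ST).
by case: S ST => // -[_ /(_ x)]; apply.
Qed.

Definition end_pieces (N : nat) (r : R) : set R := `[0, c] `|` `[c + N%:R, r].

(** The cutoff at [phi c] mirrors the vanishing of the module there, so that the decomposition of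
    ranks holds at all levels. *)
Definition end_rank (N : nat) (r s t : R) : nat :=
  if t < phi c then ncls (joined phi t) (sublevel phi (end_pieces N r) s)
  else 0%N.

Lemma pm_rank_decomposition (N : nat) r s t (st : s < t) : 0 <= c ->
  c + N%:R <= r -> pm_rank F phi `[0, r] st =
  (N * pm_rank F phi `[c, (c + 1)%R] st + end_rank N r s t)%N.
Proof.
move=> c0 cNr; have N0 : 0 <= N%:R :> R by [].
have c0r : 0 <= c <= r by apply/andP; split; lra.
have cc1 : c <= c <= c + 1 by apply/andP; split; lra.
rewrite /end_rank; case: ltP => tc; last first.
  by rewrite !pm_rank_ge_max// muln0.
by rewrite !pm_rank_ncls//; apply: ncls_decomposition.
Qed.

Lemma bounded_classes_end_pieces N r s t : s < t ->
  bounded_classes (joined phi t) (sublevel phi (end_pieces N r) s).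
Proof.
move=> st; rewrite sublevelU.
by apply: bounded_classesU; apply: bounded_classes_sublevel.
Qed.

(** This makes the end pieces contribute nonnegative multiplicities. Below the maximum it is
    [ncls_box]; if [phi c <= t] the terms at [t] vanish and monotonicity of [ncls] in the set
    remains. *)
Lemma end_rank_box N r a b s t : a < b -> b < s -> s < t ->
  (end_rank N r a s + end_rank N r b t <=
   end_rank N r b s + end_rank N r a t)%N.
Proof.
move=> ab bs st; rewrite /end_rank.
have sub : sublevel phi (end_pieces N r) a `<=` sublevel phi (end_pieces N r) b.
  by move=> x [Jx /= xa]; split=> //=; apply/(le_trans xa)/ltW.
have refl : {in sublevel phi (end_pieces N r) b, forall x, joined phi s x x}.
  by move=> x /set_mem[_ /= xb]; apply/joined_refl/(le_trans xb)/ltW.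
have bd := bounded_classes_end_pieces N r bs.
have [tc|ct] := ltP t (phi c).
  rewrite (lt_trans st tc); apply: ncls_box => //;
    try exact: joined_sym; try exact: joined_trans.
  by move=> x y; apply/joined_le/ltW.
rewrite !addn0; case: ltP => // sc.
by apply: ncls_le => //; [exact: joined_sym|exact: joined_trans].
Qed.

(** Each end piece has length at most 1, so counting cells of length [d] bounds its classes
    independently of [N] and [r]. *)
Lemma end_rank_le N (r s t d : R) : 0 < d -> s < t ->
  (forall x y, `|x - y| < d -> phi x <= s -> phi y <= t) ->
  0 <= c <= 1 -> r <= c + N%:R + 1 ->
  (end_rank N r s t <= 2 * (Num.truncn (1 / d)).+1)%N.
Proof.
move=> d0 st mod_d c01 rN; rewrite /end_rank; case: ifP => // tc.
have [|||S ST] :=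
    @transversal_exists _ (joined phi t) (sublevel phi (end_pieces N r) s).
- exact: joined_sym.
- by move=> y /set_mem[_ /= ys]; apply/joined_refl/(le_trans ys)/ltW.
- exact: bounded_classes_end_pieces.
rewrite (ncls_eq (joined_sym _ _) (@joined_trans _ _ _) ST).
have [[SX Sp] _] := ST.
have piece u v (S' := [seq x <- S | `[< u <= x <= v >]]) : v - u <= 1 ->
    (size S' <= (Num.truncn (1 / d)).+1)%N.
  move=> uv; apply: (@leq_trans (Num.truncn ((v - u) / d)).+1).
    apply: (independent_sublevel_size d0 mod_d); split.
      move=> x; rewrite mem_filter => /andP[/asboolP xuv /SX[_ xs]].
      by split=> //=; rewrite in_itv.
    exact: pairwise_filter.
  rewrite ltnS; apply: Num.Theory.le_truncn.
  by rewrite ler_pM2r ?invr_gt0.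
have p1 : c - 0 <= 1 by rewrite subr0; case/andP: c01.
have p2 : r - (c + N%:R) <= 1 by lra.
have := leq_add (piece _ _ p1) (piece _ _ p2); rewrite addnn -mul2n.
apply: leq_trans; rewrite !size_filter -count_predUI.
set P := predU _ _; suff : all P S.
  by rewrite all_count => /eqP->; apply: leq_addr.
apply/allP => x /SX[Jx _] /=; apply/orP.
by case: Jx; rewrite /= in_itv /= => xuv; [left|right]; apply/asboolP.
Qed.



End Ranks.

(** * Multiplicities from ranks *)

(** Otherwise the sets containing all but finitely many points of the intersection form a proper
    filter. It has a cluster point in [K], yet it contains the complement of a neighbourhood of that
    point. *)
Lemma compact_locally_finite (T : topologicalType) (K Z : set T) : compact K ->
  (forall x, K x -> exists2 U, nbhs x U & finite_set (U `&` Z)) ->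
  finite_set (K `&` Z).
Proof.
move=> cK locfin; apply: contrapT => infZ.
pose G : set_system T := [set B | finite_set ((K `&` Z) `\` B)].
have PG : ProperFilter G.
  split; first by rewrite /G /= setD0.
  split; first by rewrite /G /= setDT.
    by move=> B C; rewrite /G /= setDIr => ? ?; rewrite finite_setU.
  by move=> B C BC; apply: sub_finite_set; apply: setDS.
have GK : G K.
  by apply: (@sub_finite_set _ _ set0) => // x [[Kx _]].
have [x [Kx clx]] := cK _ PG GK.
have [U xU UZ] := locfin x Kx.
have GU : G (~` U).
  by apply: sub_finite_set UZ => y [[_ Zy]] /contrapT.
by have [y []] := clx _ _ GU xU.
Qed.

(** For each entry of [L] in turn, keep a half of the current interval whose interior misses it. *)
Lemma itv_avoid_seq (R : realType) (u v : R) (L : seq R) : u < v ->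
  exists2 s, u < s < v & s \notin L.
Proof.
move=> uv.
suff [u' [v' [u'v' uu' v'v L']]] : exists u' v', [/\ u' < v', u <= u', v' <= v &
    {in L, forall x, ~~ (u' < x < v')}].
  exists ((u' + v') / 2); first by apply/andP; split; lra.
  by apply/negP => /L'/negP; apply; apply/andP; split; lra.
elim: L => [|x L [u' [v' [u'v' uu' v'v L']]]]; first by exists u, v.
pose w := (u' + v') / 2; have [xw|/ltW wx] := leP x w.
  exists w, v'; split=> //; rewrite /w; [lra|lra|].
  move=> y; rewrite inE => /orP[/eqP->|/L']; first by rewrite ltNge xw.
  by apply: contraNN => /andP[? ->]; rewrite andbT; rewrite /w in xw *; lra.
exists u', w; split=> //; rewrite /w; [lra|lra|].
move=> y; rewrite inE => /orP[/eqP->|/L'].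
  by rewrite [x < _]ltNge wx andbF.
by apply: contraNN => /andP[-> ?] /=; lra.
Qed.

Section Diagram.
Context {R : realType} {F : fieldType} {h : R -> R} {X : set R}.
Context {D : multiset (R * R)}.
Hypothesis hD : is_persistence_diagram F h X D.

Definition off_diagonal : set (R * R) := [set x | x.1 < x.2 /\ D x != Some 0%N].

Lemma finite_off_diagonal K : compact K -> (forall x, K x -> x.1 < x.2) ->
  finite_set (K `&` off_diagonal).
Proof.
move=> cK Klt; apply: compact_locally_finite => // x /Klt.
exact: pd_locally_finite hD _.
Qed.

Lemma off_diagonalN x : x.1 < x.2 -> ~ off_diagonal x -> D x = Some 0%N.
Proof. by move=> x12 /not_andP[//|/negP/negPn/eqP]. Qed.

Lemma mult_eq0 x : x.1 < x.2 -> mult D x = 0%N -> D x = Some 0%N.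
Proof.
move=> x12; have := pd_finite hD x12; rewrite /mult.
by case: (D x) => //= n _ ->.
Qed.

Lemma isolated_point x : x.1 < x.2 -> exists2 d, 0 < d &
  forall y, `|x.1 - y.1| < d -> `|x.2 - y.2| < d -> off_diagonal y -> y = x.
Proof.
move=> x12; have [U xU finU] := pd_locally_finite hD x12.
have clB : closed ((U `&` off_diagonal) `\ x).
  have [acc _] := @accessible_finite_set_closed (R * R)%type.
  apply: acc; first exact/hausdorff_accessible/norm_hausdorff.
  exact: finite_setD.
have : nbhs x (U `&` ~` ((U `&` off_diagonal) `\ x)).
  apply: filterI => //; apply: open_nbhs_nbhs; split; first exact: closed_openC.
  by move=> [_ /(_ erefl)].
move=> /nbhs_ballP[d /= d0 dU]; exists d => // y y1 y2 Dy.
have [|Uy] := dU y; first by split.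
by move=> nB; apply: contrapT => yx; apply: nB.
Qed.

(** A small square about [x] contains no other point of the diagram. Stating this for all small [d]
    lets two diagrams be read off the same square. *)
Lemma mult_near x : x.1 < x.2 -> \forall d \near 0^'+,
  forall (ab : x.1 - d < x.1 + d) (bs : x.1 + d < x.2 - d)
    (st : x.2 - d < x.2 + d),
  (mult D x)%:Z = (pm_rank F h X bs)%:Z - (pm_rank F h X (lt_trans ab bs))%:Z
     - (pm_rank F h X (lt_trans bs st))%:Z
     + (pm_rank F h X (lt_trans ab (lt_trans bs st)))%:Z.
Proof.
move=> x12; have [d0 d0_gt0 iso] := isolated_point x12.
near=> d => ab bs st.
have d_gt0 : 0 < d by near: d; exact: nbhs_right_gt.
have d_lt : d < d0 by near: d; exact: nbhs_right_lt.
have box y : (`[x.1 - d, x.1 + d] `*` `[x.2 - d, x.2 + d])%classic y ->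
    y <> x -> D y = Some 0%N.
  move=> [/=]; rewrite !in_itv /= => /andP[y1 y1'] /andP[y2 y2'] yx.
  apply: off_diagonalN => [|Dy]; first by lra.
  by apply: yx; apply: iso => //; rewrite ltr_norml; apply/andP; split; lra.
rewrite -(pd_rectangle hD); last first.
  move=> y [ybox ynint]; apply: box => // yx; apply: ynint.
  by rewrite yx; split; rewrite /= in_itv /=; apply/andP; split; lra.
rewrite -(fsbig_widen [set x]) ?fsbig_set1//.
  by move=> _ ->; split; rewrite /= in_itv /=; apply/andP; split; lra.
by move=> y [ybox yx] /=; rewrite /mult box.
Unshelve. all: by end_near. Qed.

Lemma mult_square x e : x.1 < x.2 -> 0 < e -> exists d
    (ab : x.1 - d < x.1 + d) (bs : x.1 + d < x.2 - d) (st : x.2 - d < x.2 + d),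
  d < e /\
  (mult D x)%:Z = (pm_rank F h X bs)%:Z - (pm_rank F h X (lt_trans ab bs))%:Z
     - (pm_rank F h X (lt_trans bs st))%:Z
     + (pm_rank F h X (lt_trans ab (lt_trans bs st)))%:Z.
Proof.
move=> x12 e_gt0; near (0 : R)^'+ => d.
have d_gt0 : 0 < d by near: d; exact: nbhs_right_gt.
have d_lt : d < (x.2 - x.1) / 2.
  by near: d; apply: nbhs_right_lt; rewrite divr_gt0// subr_gt0.
have ab : x.1 - d < x.1 + d by lra.
have bs : x.1 + d < x.2 - d by lra.
have st : x.2 - d < x.2 + d by lra.
exists d, ab, bs, st; split; first by near: d; exact: nbhs_right_lt.
have E := near (mult_near x12) d _ ab bs st.
exact: E.
Unshelve. all: by end_near. Qed.

End Diagram.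

(** * Supports of diagrams *)

Section Strip.
Context {R : realType}.

(** For [eps > 0] this is compact and away from the diagonal, so a diagram has finitely many points
    in it. *)
Definition strip (m M eps : R) : set (R * R) :=
  [set x | [/\ m <= x.1, x.2 <= M & eps <= x.2 - x.1]].

Lemma strip_lt m M eps x : 0 < eps -> strip m M eps x -> x.1 < x.2.
Proof. by move=> eps0 [_ _]; lra. Qed.

Lemma compact_strip m M eps : 0 < eps -> compact (strip m M eps).
Proof.
move=> eps0; apply: (@subclosed_compact _ _ (`[m, M] `*` `[m, M])%classic).
- have -> : strip m M eps = [set x | m <= x.1] `&` [set x | x.2 <= M] `&`
      [set x | eps <= x.2 - x.1].
    by apply/seteqP; split=> x [] => [|[]].
  have cB : continuous (fun x : R * R => x.2 - x.1).
    by move=> x; apply: cvgB; [exact: cvg_snd|exact: cvg_fst].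
  apply: closedI; first apply: closedI.
  + by apply: (preimage_closed (D := [set x | m <= x])) => [x _|];
      [exact: cvg_fst|exact: closed_ge].
  + by apply: (preimage_closed (D := [set x | x <= M])) => [x _|];
      [exact: cvg_snd|exact: closed_le].
  + by apply: (preimage_closed (D := [set x | eps <= x])) => [x _|];
      [exact: cB|exact: closed_ge].
- by apply: compact_setX; exact: segment_compact.
- move=> [a b] [/= ? ? ?].
  by split=> /=; rewrite in_itv /=; apply/andP; split; lra.
Qed.

End Strip.

Section Support.
Context {R : realType} {F : fieldType} {h : R -> R} {X : set R}.
Context {D : multiset (R * R)} {m M : R}.
Hypothesis hD : is_persistence_diagram F h X D.
Hypothesis rank_low : forall s t (st : s < t), s < m -> pm_rank F h X st = 0%N.
Hypothesis rank_high :
  forall s t (st : s < t), M <= t -> pm_rank F h X st = 0%N.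

(** Around a point born before [m] or dying after [M], a small square involves only vanishing ranks,
    so the multiplicity is 0. *)
Lemma off_diagonal_range x : off_diagonal (D := D) x -> m <= x.1 /\ x.2 <= M.
Proof.
move=> [x12 /eqP Dx].
split; rewrite leNgt; apply/negP => xout; apply/Dx/(mult_eq0 hD x12)/eqP;
  rewrite -eqz_nat; move: (xout); rewrite -subr_gt0.
- move=> /(mult_square hD x12)[d [ab [bs [st [dm ->]]]]].
  by rewrite !rank_low//; lra.
- move=> /(mult_square hD x12)[d [ab [bs [st [dM ->]]]]].
  by rewrite !rank_high//; lra.
Qed.

Lemma weight_support eps x : 0 < eps ->
  ~ (strip m M eps `&` off_diagonal (D := D)) x ->
  weight eps x = 0 \/ mult D x = 0%N.
Proof.
move=> eps0 nDx; have [xeps|epsx] := leP (x.2 - x.1) eps.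
  by left; rewrite /weight max_r// subr_le0.
have x12 : x.1 < x.2 by lra.
right; rewrite /mult (off_diagonalN x12)// => Dx; apply: nDx; split=> //.
by have [mx xM] := off_diagonal_range Dx; split=> //; exact: ltW.
Qed.

(** Births up to [s] and deaths from [t] on, cut off beyond the range of the diagram to fit the
    rectangle formula. *)
Definition quadrant (s t : R) : set (R * R) :=
  (`[m - 1, s] `*` `[t, (Num.max M t + 1)])%classic.

(** With the outer sides beyond the range of the diagram, three of the four ranks in the rectangle
    formula vanish. The two avoidance hypotheses keep points off the inner sides. *)
Lemma sum_mult_quadrant s t (st : s < t) (P : seq (R * R)) : m - 1 < s ->
  (forall x, off_diagonal (D := D) x -> x.1 = s -> x.2 < t) ->
  (forall x, off_diagonal (D := D) x -> x.2 = t -> s < x.1) ->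
  uniq P -> [set` P] `<=` quadrant s t ->
  quadrant s t `&` off_diagonal (D := D) `<=` [set` P] ->
  (\sum_(x <- P) mult D x = pm_rank F h X st)%N.
Proof.
move=> ms gens gent uP PQ QP.
have tM : t < Num.max M t + 1 by rewrite ltr_pwDr// le_max lexx orbT.
have Qlt x : quadrant s t x -> x.1 < x.2.
  by case=> /=; rewrite !in_itv /= => /andP[_ xs] /andP[tx _]; lra.
apply/eqP; rewrite -eqz_nat; apply/eqP.
have := @pd_rectangle _ _ _ _ _ hD _ _ _ _ ms st tM.
rewrite (rank_low (lt_trans ms st)); last by lra.
rewrite (rank_high (lt_trans st tM)); last first.
  by apply: (@le_trans _ _ (Num.max M t)); [rewrite le_max lexx|lra].
rewrite (rank_low (lt_trans ms (lt_trans st tM))); last by lra.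
rewrite !subr0 => <-; last first.
  move=> x [Qx xbd]; apply: off_diagonalN (Qlt _ Qx) _ => Dx.
  have [xm xM] := off_diagonal_range Dx.
  have MM : M < Num.max M t + 1 by rewrite ltr_pwDr// le_max lexx.
  apply: xbd; move: Qx => [/=]; rewrite !in_itv /= => /andP[_ xs] /andP[tx _].
  split; apply/andP; split; [lra| |  |lra].
    rewrite lt_neqAle xs andbT; apply/eqP => /(gens _ Dx); lra.
  by rewrite lt_neqAle tx andbT; apply/eqP => /esym/(gent _ Dx); lra.
rewrite -(fsbig_widen [set` P])//; last first.
  move=> x [Qx Px] /=; rewrite /mult off_diagonalN ?(Qlt _ Qx)// => Dx.
  by apply: Px; apply: QP.
rewrite -fsbig_seq// -[LHS]natz natr_sum.
by apply: eq_bigr => x _; rewrite natz.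
Qed.

End Support.

(** * Excess of one diagram over copies of another *)

Section Comparison.
Context {R : realType} {F : fieldType} {h : R -> R} {X1 X2 : set R}.
Context {D1 D2 : multiset (R * R)} {m M : R} {N : nat} {err : R -> R -> nat}.
Hypothesis hD1 : is_persistence_diagram F h X1 D1.
Hypothesis hD2 : is_persistence_diagram F h X2 D2.
Hypothesis low1 : forall s t (st : s < t), s < m -> pm_rank F h X1 st = 0%N.
Hypothesis low2 : forall s t (st : s < t), s < m -> pm_rank F h X2 st = 0%N.
Hypothesis high1 : forall s t (st : s < t), M <= t -> pm_rank F h X1 st = 0%N.
Hypothesis high2 : forall s t (st : s < t), M <= t -> pm_rank F h X2 st = 0%N.
Hypothesis rank_decomp : forall s t (st : s < t),
  pm_rank F h X1 st = (N * pm_rank F h X2 st + err s t)%N.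
Hypothesis err_box : forall a b s t, a < b -> b < s -> s < t ->
  (err a s + err b t <= err b s + err a t)%N.

(** Both multiplicities are read off one small square. By [rank_decomp] they differ, after the
    factor [N], by an alternating sum of [err], nonnegative by [err_box]. *)
Lemma mult_le x : x.1 < x.2 -> (N * mult D2 x <= mult D1 x)%N.
Proof.
move=> x12; near (0 : R)^'+ => d.
have d_gt0 : 0 < d by near: d; exact: nbhs_right_gt.
have d_lt : d < (x.2 - x.1) / 2.
  by near: d; apply: nbhs_right_lt; rewrite divr_gt0// subr_gt0.
have ab : x.1 - d < x.1 + d by lra.
have bs : x.1 + d < x.2 - d by lra.
have st : x.2 - d < x.2 + d by lra.
have E1 := near (mult_near hD1 x12) d _ ab bs st.
have E2 := near (mult_near hD2 x12) d _ ab bs st.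
have := err_box ab bs st.
suff : (mult D1 x)%:Z = N%:Z * (mult D2 x)%:Z + (err (x.1 + d) (x.2 - d))%:Z
    - (err (x.1 - d) (x.2 - d))%:Z - (err (x.1 + d) (x.2 + d))%:Z
    + (err (x.1 - d) (x.2 + d))%:Z.
  by move: (mult D1 x) (mult D2 x) => k1 k2; nia.
rewrite E1; last by [].
rewrite E2; last by [].
by rewrite !rank_decomp !PoszD !PoszM; ring.
Unshelve. all: by end_near. Qed.

(** The truncated subtraction is exact above the diagonal, by [mult_le]. *)
Definition excess x : nat := (mult D1 x - N * mult D2 x)%N.

Lemma mult_excess x : x.1 < x.2 -> mult D1 x = (N * mult D2 x + excess x)%N.
Proof. by move=> /mult_le ?; rewrite /excess subnKC. Qed.

Lemma strip_support eps : 0 < eps -> exists2 L : seq (R * R), uniq L &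
  [set` L] = strip m M eps `&`
    (off_diagonal (D := D1) `|` off_diagonal (D := D2)).
Proof.
move=> eps0; have cK := @compact_strip _ m M eps eps0.
have Klt x : strip m M eps x -> x.1 < x.2 by exact: strip_lt.
have /finite_seqP[L E] : finite_set (strip m M eps `&`
    (off_diagonal (D := D1) `|` off_diagonal (D := D2))).
  by rewrite setIUr finite_setU; split; [exact: (finite_off_diagonal hD1)
    |exact: (finite_off_diagonal hD2)].
exists (undup L); first exact: undup_uniq.
by rewrite E; apply/seteqP; split=> x /=; rewrite mem_undup.
Qed.

Lemma compact_quadrant (s t : R) : compact (quadrant (m := m) (M := M) s t).
Proof. by apply: compact_setX; exact: segment_compact. Qed.

Variables (eta : R) (K : nat).
Hypothesis eta_gt0 : 0 < eta.
Hypothesis err_le : forall s t, s + eta < t -> (err s t <= K)%N.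

(* The thresholds [s] and [t] are moved off the finitely many coordinates of
   points of the diagrams, as the rectangle formula requires. *)
Lemma sum_excess_slab (u : R) (P : seq (R * R)) : m <= u -> uniq P ->
  {in P, forall x,
    [/\ m <= x.1, x.1 <= u + eta, x.2 <= M & u + 4 * eta <= x.2]} ->
  (\sum_(x <- P) excess x <= K)%N.
Proof.
move=> mu uP Pslab; have eta0 := eta_gt0.
have [L uL LE] := strip_support eta_gt0.
(* [s] and [t] lie strictly between the births and the deaths in [P], with [t - s > eta] so that
   [err_le] applies. *)
have [s /andP[us su] sL] :
    exists2 s, u + eta < s < u + 2 * eta & s \notin map fst L.
  by apply: itv_avoid_seq; lra.
have [t /andP[ut tu] tL] :
    exists2 t, u + 3 * eta < t < u + 4 * eta & t \notin map snd L.
  by apply: itv_avoid_seq; lra.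
have st : s < t by lra.
have ms : m - 1 < s by lra.
pose Q := quadrant (m := m) (M := M) s t.
have Qlt x : Q x -> x.1 < x.2.
  by case=> /=; rewrite !in_itv /= => /andP[_ xs] /andP[tx _]; lra.
have /finite_seqP[L' L'E] : finite_set (Q `&`
    (off_diagonal (D := D1) `|` off_diagonal (D := D2))).
  rewrite setIUr finite_setU.
  by split;
    [apply: (finite_off_diagonal hD1)|apply: (finite_off_diagonal hD2)] => //;
    exact: compact_quadrant.
(* Adding all diagram points of the quadrant makes both sums of multiplicities equal to ranks. *)
pose P' := undup (P ++ L').
have uP' : uniq P' by exact: undup_uniq.
have P'Q : [set` P'] `<=` Q.
  move=> x; rewrite /= mem_undup mem_cat => /orP[/Pslab[mx xu xM ux]|xL'].
    split; rewrite /= in_itv /=; apply/andP; split; try lra.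
    apply: (le_trans xM).
    by rewrite (@le_trans _ _ (Num.max M t)) ?le_max ?lexx ?lerDl.
  by have : [set` L'] x by []; rewrite -L'E => -[].
have QP' :
    Q `&` (off_diagonal (D := D1) `|` off_diagonal (D := D2)) `<=` [set` P'].
  by move=> x; rewrite L'E /= mem_undup mem_cat => ->; rewrite orbT.
have inL (x : R * R) : m <= x.1 /\ x.2 <= M -> eta <= x.2 - x.1 ->
    off_diagonal (D := D1) x \/ off_diagonal (D := D2) x -> x \in L.
  move=> [mx xM] xeta Dx; suff : [set` L] x by [].
  by rewrite LE.
have sum1 : (\sum_(x <- P') mult D1 x = pm_rank F h X1 st)%N.
  apply: (sum_mult_quadrant hD1 low1 high1) => //.
  - move=> x Dx xs; rewrite ltNge; apply/negP => tx; case/negP: sL.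
    apply/mapP; exists x => //; apply: inL; [|lra|by left].
    exact: (off_diagonal_range hD1 low1 high1).
  - move=> x Dx xt; rewrite ltNge; apply/negP => xs; case/negP: tL.
    apply/mapP; exists x => //; apply: inL; [|lra|by left].
    exact: (off_diagonal_range hD1 low1 high1).
  - by move=> x [Qx Dx]; apply: QP'; split => //; left.
have sum2 : (\sum_(x <- P') mult D2 x = pm_rank F h X2 st)%N.
  apply: (sum_mult_quadrant hD2 low2 high2) => //.
  - move=> x Dx xs; rewrite ltNge; apply/negP => tx; case/negP: sL.
    apply/mapP; exists x => //; apply: inL; [|lra|by right].
    exact: (off_diagonal_range hD2 low2 high2).
  - move=> x Dx xt; rewrite ltNge; apply/negP => xs; case/negP: tL.
    apply/mapP; exists x => //; apply: inL; [|lra|by right].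
    exact: (off_diagonal_range hD2 low2 high2).
  - by move=> x [Qx Dx]; apply: QP'; split => //; right.
(* By [rank_decomp] the total excess in the quadrant is exactly [err s t]. *)
have : (\sum_(x <- P') excess x = err s t)%N.
  apply/eqP; rewrite -(eqn_add2l (N * pm_rank F h X2 st)) -rank_decomp.
  rewrite -sum1 -sum2 big_distrr -big_split /=.
  apply/eqP; apply: eq_big_seq => x xP'.
  by rewrite -mult_excess//; apply/Qlt/P'Q.
move=> sumE; apply: (@leq_trans (err s t)); last by apply: err_le; lra.
rewrite -sumE.
have PP' : {subset P <= P'} by move=> x; rewrite mem_undup mem_cat => ->.
by apply: (uniq_sub_le_big (le := leq)) => // *;
  rewrite ?leq_addr ?leq_add.
Qed.

(** Slice the strip by birth into slabs of width [eta], each of which carries excess at most [K]. *)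
Lemma sum_excess_strip (P : seq (R * R)) : uniq P ->
  {in P, forall x, strip m M (4 * eta) x} ->
  (\sum_(x <- P) excess x <= (Num.truncn ((M - m) / eta)).+1 * K)%N.
Proof.
move=> uP Pstrip; set G := Num.truncn _.
have eta0 := eta_gt0; pose f (x : R * R) := Num.truncn ((x.1 - m) / eta).
rewrite big_seq (partition_big (fun x => inord (f x) : 'I_G.+1) xpredT)//=.
rewrite -[G.+1 in leqRHS]card_ord -sum_nat_const; apply: leq_sum => i _.
rewrite -big_seq_cond -big_filter; apply: (@sum_excess_slab (m + i%:R * eta)).
- by rewrite lerDl mulr_ge0// ltW.
- exact: filter_uniq.
move=> x; rewrite mem_filter => /andP[/eqP fxi /Pstrip[mx xM xeta]].
have fxE : f x = i.
  rewrite -fxi inordK// ltnS; apply: Num.Theory.le_truncn.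
  by rewrite ler_pM2r ?invr_gt0//; lra.
have : (f x)%:R <= (x.1 - m) / eta < (f x).+1%:R.
  by apply: Num.Theory.truncn_itv; rewrite divr_ge0 ?subr_ge0// ltW.
rewrite ler_pdivlMr// ltr_pdivrMr// fxE -natr1 mulrDl mul1r.
by move: (i%:R * eta) => q /andP[? ?]; split; lra.
Qed.

End Comparison.

(** * Normalized functionals *)

Section Functional.
Context {R : realType}.

Lemma msum_seq (D : multiset (R * R)) (f : R * R -> R) (L : seq (R * R)) :
  uniq L -> (forall x, x \notin L -> f x *+ mult D x = 0) ->
  Defs.msum D f = \sum_(x <- L) f x *+ mult D x.
Proof.
move=> uL f0; rewrite /Defs.msum [RHS]fsbig_seq//.
apply/esym/fsbig_widen => //.
by move=> x [_ /= /negP]; apply: f0.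
Qed.

Lemma weight_ge0 (eps : R) x : 0 <= weight eps x.
Proof. by rewrite /weight le_max lexx orbT. Qed.

Lemma supnorm_le (T : Type) (f : T -> R) (b : R) :
  (supnorm f <= b%:E)%E <-> forall t, `|f t| <= b.
Proof.
split=> [h t|h].
  by rewrite -lee_fin; apply: le_trans h; apply: ereal_sup_ubound; exists t.
by apply: ge_ereal_sup => _ [t _ <-]; rewrite lee_fin.
Qed.

(** The difference is [(E * W - S * e) / ((N * W + e) * W)], and each product in the numerator is at
    most [G * e * W] in absolute value. *)
Lemma quotient_perturbation (N W S e E G : R) : 0 < N -> 0 < W -> 0 <= e ->
  `|S| <= G * W -> `|E| <= G * e ->
  `|(N * S + E) / (N * W + e) - S / W| <= 2 * G * e / (N * W).
Proof.
move=> N0 W0 e0 SW Ee.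
have NW : 0 < N * W by rewrite mulr_gt0.
have NWe : 0 < N * W + e by rewrite ltr_wpDr.
have G0 : 0 <= G by rewrite -(pmulr_lge0 _ W0) (le_trans _ SW).
have -> : (N * S + E) / (N * W + e) - S / W =
    (E * W - S * e) / ((N * W + e) * W).
  by field; rewrite !gt_eqF.
rewrite normrM normfV (gtr0_norm (mulr_gt0 NWe W0)) ler_pdivrMr ?mulr_gt0//.
have h1 : `|E * W - S * e| <= 2 * G * e * W.
  apply: le_trans (ler_normB _ _) _.
  rewrite !normrM (gtr0_norm W0) (ger0_norm e0).
  have := ler_wpM2r (ltW W0) Ee; have := ler_wpM2r e0 SW; lra.
apply: (le_trans h1).
have -> : 2 * G * e / (N * W) * ((N * W + e) * W) =
    2 * G * e * W + 2 * G * e * e * W / (N * W).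
  by field; rewrite !gt_eqF.
by rewrite lerDl !mulr_ge0// ?invr_ge0 ltW.
Qed.

(** Compare [x] with the diagonal point [(x.1, x.1)], at distance [x.2 - x.1], which is at most
    [M - m]. *)
Lemma kernel_strip_bound (T : Type) (k : R * R -> T -> R) (m M eps L C : R) :
  0 < eps -> 0 <= L ->
  (forall x x' : R * R, (supnorm (k x \- k x')%R <= (L * `|x - x'|)%:E)%E) ->
  (forall r : R, (supnorm (k (r, r)) <= C%:E)%E) ->
  forall x, strip m M eps x -> forall t, `|k x t| <= C + L * (M - m).
Proof.
move=> eps0 L0 k_lip k_diag x xS t; have [mx xM ex] := xS.
have /supnorm_le/(_ t) := k_diag x.1.
have /supnorm_le/(_ t) := k_lip x (x.1, x.1).
have -> : `|x - (x.1, x.1)| = x.2 - x.1.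
  rewrite prod_normE /= subrr normr0 ger0_norm; last by lra.
  by rewrite max_r//; lra.
move=> h1 h2; have : L * (x.2 - x.1) <= L * (M - m) by rewrite ler_wpM2l//; lra.
have := ler_normD (k x t - k (x.1, x.1) t) (k (x.1, x.1) t).
by rewrite subrK; move: h1 => /=; lra.
Qed.

End Functional.

(** * Comparison of normalized functionals *)

Section RhobarComparison.
Context {R : realType} {T : Type} (k : R * R -> T -> R) (eps p G E0 : R).
Context (D1 D2 : multiset (R * R)) (N : nat) (e : R * R -> nat).
Context (L : seq (R * R)).
Hypotheses (uL : uniq L) (N_gt0 : (0 < N)%N) (p_neq0 : p != 0).
Hypothesis supp1 : forall x, x \notin L -> weight eps x = 0 \/ mult D1 x = 0%N.
Hypothesis supp2 : forall x, x \notin L -> weight eps x = 0 \/ mult D2 x = 0%N.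
Hypothesis mult12 : {in L, forall x, mult D1 x = (N * mult D2 x + e x)%N}.
Hypothesis k_le : forall x t, x \in L -> `|k x t| <= G.
Hypothesis e_le : \sum_(x <- L) weight eps x `^ p *+ e x <= E0.
Hypothesis den_gt0 : 0 < Defs.msum D2 (fun x => weight eps x `^ p).

(** By [mult12] the numerator and denominator for [D1] are [N] times those for [D2] plus sums over
    [e], the form treated by [quotient_perturbation]. *)
Lemma rhobar_comparison t : `|rhobar k eps p D1 t - rhobar k eps p D2 t| <=
  2 * G * E0 / (N%:R * Defs.msum D2 (fun x => weight eps x `^ p)).
Proof.
pose w x := weight eps x `^ p.
have w0 x : 0 <= w x by exact: powR_ge0.
have msumE D (f : R * R -> R) :
    (forall x, x \notin L -> weight eps x = 0 \/ mult D x = 0%N) ->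
    Defs.msum D (fun x => w x * f x) = \sum_(x <- L) (w x * f x) *+ mult D x.
  move=> supp; apply: msum_seq => // x /supp[wx|->]; last by rewrite mulr0n.
  by rewrite /w wx powR0// mul0r mul0rn.
have sumE (f : R * R -> R) : \sum_(x <- L) (w x * f x) *+ mult D1 x =
    N%:R * (\sum_(x <- L) (w x * f x) *+ mult D2 x) +
    \sum_(x <- L) (w x * f x) *+ e x.
  rewrite mulr_sumr -big_split /=; apply: eq_big_seq => x xL.
  by rewrite mult12// mulrnDr mulnC mulrnA mulr_natl.
(* The denominator is the numerator for the constant kernel 1, so [sumE] covers both. *)
have denE D : Defs.msum D (fun x => weight eps x `^ p) =
    Defs.msum D (fun x => w x * 1).
  by congr Defs.msum; apply/funext => x; rewrite mulr1.
have norm_le (g : R * R -> nat) : `|\sum_(x <- L) (w x * k x t) *+ g x| <=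
    G * \sum_(x <- L) (w x * 1) *+ g x.
  apply: le_trans (ler_norm_sum _ _ _) _; rewrite mulr_sumr.
  rewrite big_seq [leRHS]big_seq; apply: ler_sum => x xL.
  rewrite normrMn normrM (ger0_norm (w0 x)) mulrnAr lerMn2r; apply/orP; right.
  by rewrite mulr1 mulrC ler_wpM2r// k_le.
have e0 : 0 <= \sum_(x <- L) (w x * 1) *+ e x.
  by apply: sumr_ge0 => x _; rewrite mulrn_wge0// mulr1.
have d0 := den_gt0; rewrite denE msumE// in d0.
rewrite /rhobar !denE !msumE// !sumE.
set W := \sum_(x <- L) _ *+ _ in d0 *; set Ew := \sum_(x <- L) _ *+ e x in e0 *.
have N0 : 0 < N%:R :> R by rewrite ltr0n.
have NW : 0 < N%:R * W by rewrite mulr_gt0.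
rewrite d0 ltr_wpDr//.
apply: le_trans (quotient_perturbation N0 d0 e0 (norm_le _) (norm_le _)) _.
have G0 : 0 <= G by rewrite -(pmulr_lge0 _ d0) (le_trans _ (norm_le _)).
rewrite ler_pM2r ?invr_gt0// ler_wpM2l ?mulr_ge0//.
by apply: le_trans e_le; rewrite /Ew; under eq_bigr do rewrite mulr1.
Qed.

Lemma rhobar_eq0 D t : (forall x, weight eps x = 0 \/ mult D x = 0%N) ->
  rhobar k eps p D t = 0.
Proof.
move=> D0; rewrite /rhobar (@msum_seq _ D _ [::])//.
  by rewrite big_nil ltxx.
by move=> x _; case: (D0 x) => ->; rewrite ?mulr0n// powR0// mul0rn.
Qed.

End RhobarComparison.

(** * The bar from global minimum to global maximum, and the limit *)

Section GlobalBar.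
Context {R : realType} {F : fieldType} {phi : R -> R} {c x0 : R}.
Hypotheses (phi_cont : continuous phi) (phi_per : periodic phi 1).
Hypotheses (c_max : forall x, phi x <= phi c).
Hypotheses (x0_min : forall x, phi x0 <= phi x).

Lemma pm_rank_low (u v s t : R) (st : s < t) : u <= c <= v -> s < phi x0 ->
  pm_rank F phi `[u, v] st = 0%N.
Proof.
move=> uv sm; apply: (pm_rank_lt_min _ phi_cont phi_per c_max) => // x.
exact: lt_le_trans sm (x0_min x).
Qed.

(** In a small square about this point every rank but one involves a birth level below the minimum
    or a death level above the maximum. The remaining rank is positive because of the class of
    [x0]. *)
Lemma global_bar (u v : R) (E : multiset (R * R)) : u <= c <= v ->
  u <= x0 <= v -> phi x0 < phi c -> is_persistence_diagram F phi `[u, v] E ->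
  (0 < mult E (phi x0, phi c))%N.
Proof.
move=> uv x0uv; set x := (phi x0, phi c) => mM hE.
have x12 : x.1 < x.2 by [].
have [|d [ab [bs [st [d_lt E1]]]]] :=
  @mult_square _ _ _ _ _ hE x (x.2 - x.1) x12.
  by rewrite subr_gt0.
have low s t (st' : s < t) : s < x.1 -> pm_rank F phi `[u, v] st' = 0%N.
  exact: pm_rank_low.
have high s t (st' : s < t) : x.2 <= t -> pm_rank F phi `[u, v] st' = 0%N.
  exact: pm_rank_ge_max.
have bs0 : (0 < pm_rank F phi `[u, v] bs)%N.
  have [x1E x2E] : x.1 = phi x0 /\ x.2 = phi c by [].
  by apply: (pm_rank_gt0 _ phi_cont phi_per c_max _ uv _ x0uv); lra.
rewrite -ltz_nat E1 (low _ _ (lt_trans ab bs)); last by lra.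
rewrite (low _ _ (lt_trans ab (lt_trans bs st))); last by lra.
rewrite (high _ _ (lt_trans bs st)); last by lra.
by rewrite !subr0 ltz_nat.
Qed.

End GlobalBar.

(** The rate behind the limit: the weighted excess over copies of one period is bounded uniformly in
    [r], while the number of copies grows with [r]. *)
Lemma rhobar_estimate (R : realType) (F : fieldType) (T : Type)
    (phi : R -> R) (eps p : R) (k : R * R -> T -> R) (c : R)
    (D : R -> multiset (R * R)) (Dc : multiset (R * R)) :
  continuous phi -> periodic phi 1 -> 0 < eps -> 0 < p ->
  (exists2 L : R, 0 < L &
     forall x x' : R * R, (supnorm (k x \- k x')%R <= (L * `|x - x'|)%:E)%E) ->
  (exists2 C : R, 0 <= C & forall r : R, (supnorm (k (r, r)) <= C%:E)%E) ->
  0 <= c <= 1 -> (forall x, phi x <= phi c) ->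
  (forall r, 0 < r -> is_persistence_diagram F phi `[0, r] (D r)) ->
  is_persistence_diagram F phi `[c, c + 1] Dc ->
  exists2 C : R, 0 <= C & forall r, c + 1 <= r -> forall t,
    `|rhobar k eps p (D r) t - rhobar k eps p Dc t|
      <= C / (Num.truncn (r - c))%:R.
Proof.
move=> phi_cont phi_per eps_gt0 p_gt0 [L L_gt0 k_lip] [C C_ge0 k_diag].
move=> c01 c_max hD hDc.
have [c_ge0 c_le1] := andP c01; have p_neq0 : p != 0 by rewrite gt_eqF.
have [x0 x0c x0_min] := periodic_min phi_cont phi_per c.
set m := phi x0; set M := phi c.
have cc1 : c <= c <= c + 1 by apply/andP; split; lra.
have low u v s t (st : s < t) : u <= c <= v -> s < m ->
    pm_rank F phi `[u, v] st = 0%N by exact: pm_rank_low.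
have high u v s t (st : s < t) : u <= c <= v -> M <= t ->
    pm_rank F phi `[u, v] st = 0%N.
  by move=> uv; apply: pm_rank_ge_max.
have lowc s t (st : s < t) := low _ _ s t st cc1.
have highc s t (st : s < t) := high _ _ s t st cc1.
have c0r r : c + 1 <= r -> 0 <= c <= r by move=> cr; apply/andP; split; lra.
have [Mm|mM] := leP (M - m) eps.
  (* Here no point of positive multiplicity above the diagonal has persistence beyond [eps], so both
     functionals are 0. *)
  exists 0 => // r cr t.
  have small X E : is_persistence_diagram F phi X E ->
      (forall s t (st : s < t), s < m -> pm_rank F phi X st = 0%N) ->
      (forall s t (st : s < t), M <= t -> pm_rank F phi X st = 0%N) ->
      forall x, weight eps x = 0 \/ mult E x = 0%N.
    move=> hE lowE highE x; have [xeps|epsx] := leP (x.2 - x.1) eps.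
      by left; rewrite /weight max_r// subr_le0.
    have x12 : x.1 < x.2 by lra.
    right; rewrite /mult (off_diagonalN x12)// => Ex.
    by have := off_diagonal_range hE lowE highE Ex; lra.
  have c0 := c0r r cr.
  rewrite !rhobar_eq0 ?subrr ?normr0 ?mul0r//.
    exact: small hDc lowc highc.
  have r_gt0 : 0 < r by lra.
  by apply: small (hD r r_gt0) _ _ => s t' st'; [exact: low|exact: high].
have mM0 : m < M by lra.
pose W := Defs.msum Dc (fun x => weight eps x `^ p).
(* The quarter turns the strip of [sum_excess_strip] into that of persistence at least [eps]. *)
pose eta := eps / 4.
have eta_gt0 : 0 < eta by rewrite /eta; lra.
have eta4 : 4 * eta = eps by rewrite /eta; lra.
have [d d_gt0 mod_d] := periodic_unif_continuous phi_cont phi_per eta_gt0.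
(* [K] bounds the end ranks across a gap above [eta], [B] the total excess, and [E0] its weighted
   sum, as weights are at most [M - m]. *)
pose K := (2 * (Num.truncn (1 / d)).+1)%N.
pose B := ((Num.truncn ((M - m) / eta)).+1 * K)%N.
pose G := C + L * (M - m).
pose E0 := (M - m) `^ p *+ B.
have bar_mM : (0 < mult Dc (m, M))%N.
  exact: (global_bar phi_cont phi_per c_max x0_min cc1 x0c mM0 hDc).
(* The bar from [m] to [M] has persistence above [eps], hence positive weight. *)
have W_gt0 : 0 < W.
  have [S uS SE] := strip_support (m := m) (M := M) hDc hDc eps_gt0.
  have mMS : (m, M) \in S.
    suff : [set` S] (m, M) by [].
    rewrite SE; split; first by split=> //; apply: ltW.
    left; split=> //; apply: contraTneq bar_mM.
    by rewrite /mult => ->.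
  rewrite /W (msum_seq uS); last first.
    move=> x xS.
    have [|->|->] := weight_support hDc lowc highc eps_gt0 (x := x).
    - move=> [xs xo]; move: xS; suff : [set` S] x by move=> /= ->.
      by rewrite SE; split=> //; left.
    - by rewrite powR0// mul0rn.
    - by rewrite mulr0n.
  rewrite (bigD1_seq (m, M))//= ltr_wpDr//.
    by apply: sumr_ge0 => x _; rewrite mulrn_wge0// powR_ge0.
  rewrite mulrn_wgt0// powR_gt0// /weight lt_max subr_gt0 /=; apply/orP; left.
  exact: mM.
have G_ge0 : 0 <= G by rewrite addr_ge0// mulr_ge0// ltW// subr_gt0.
have E0_ge0 : 0 <= E0 by rewrite mulrn_wge0// powR_ge0.
exists (2 * G * E0 / W); first by rewrite divr_ge0 ?mulr_ge0// ltW.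
move=> r cr t; set N := Num.truncn _.
have r_gt0 : 0 < r by lra.
have c0 := c0r r cr; have hDr := hD r r_gt0.
have lowr s t' (st : s < t') := low _ _ s t' st c0.
have highr s t' (st : s < t') := high _ _ s t' st c0.
have rc0 : 0 <= r - c by lra.
have /andP[Nr rN] := Num.Theory.truncn_itv rc0.
have N_gt0 : (0 < N)%N by rewrite Num.Theory.truncn_gt0; lra.
have cNr : c + N%:R <= r by rewrite /N; lra.
have rcN : r <= c + N%:R + 1 by rewrite -natr1 in rN; rewrite /N; lra.
have decomp s t' (st : s < t') :=
  pm_rank_decomposition F phi_cont phi_per c_max st c_ge0 cNr.
have box := end_rank_box c phi_cont phi_per N r.
have err_le s t' : s + eta < t' -> (end_rank phi c N r s t' <= K)%N.
  move=> st; apply: (end_rank_le phi_cont phi_per d_gt0) => //; first by lra.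
  by move=> x y /mod_d; rewrite ltr_norml => /andP[? ?] ?; lra.
have [S uS SE] := strip_support (m := m) (M := M) hDr hDc eps_gt0.
have Sstrip x : x \in S -> strip m M eps x.
  by move=> xS; have : [set` S] x by []; rewrite SE => -[].
have notS x : x \notin S -> ~ (strip m M eps `&`
    (off_diagonal (D := D r) `|` off_diagonal (D := Dc))) x.
  by rewrite -SE /= => /negP.
rewrite -[leRHS]mulrA -invfM [W * _]mulrC.
apply: (@rhobar_comparison _ _ _ _ _ _ _ _ _ _
  (excess (D1 := D r) (D2 := Dc) (N := N)) S) => //.
- move=> x /notS xS; apply: (weight_support hDr lowr highr eps_gt0) => -[? ?].
  by apply: xS; split=> //; left.
- move=> x /notS xS; apply: (weight_support hDc lowc highc eps_gt0) => -[? ?].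
  by apply: xS; split=> //; right.
- move=> x /Sstrip/(strip_lt eps_gt0) x12.
  refine (mult_excess (err := end_rank phi c N r) hDr hDc decomp box x12).
- move=> x t' /Sstrip xS.
  exact: kernel_strip_bound eps_gt0 (ltW L_gt0) k_lip k_diag _ xS _.
apply: (@le_trans _ _ (\sum_(x <- S)
    (M - m) `^ p *+ excess (D1 := D r) (D2 := Dc) (N := N) x)).
  rewrite big_seq [leRHS]big_seq; apply: ler_sum => x /Sstrip[mx xM ex].
  have xMm : 0 <= x.2 - x.1 - eps <= M - m by apply/andP; split; lra.
  rewrite lerMn2r; apply/orP; right; apply: ge0_ler_powR; first exact: ltW.
  - exact: weight_ge0.
  - by rewrite nnegrE ltW// subr_gt0.
  - by rewrite /weight max_l; case/andP: xMm.
rewrite sumrMnr /E0 ler_wpMn2l ?powR_ge0//.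
apply: (sum_excess_strip hDr hDc lowr lowc highr highc decomp box
  eta_gt0 err_le) => //.
by move=> x /Sstrip; rewrite eta4.
Qed.



Theorem theorem2p3 (R : realType) (F : fieldType) (n : nat)
  (phi : R -> R) (eps p : R) (k : R * R -> 'rV[R]_n -> R) (c : R)
  (phi_cont : continuous phi)
  (phi_per : periodic phi 1)
  (eps_gt0 : 0 < eps) (p_gt1 : 1 < p)
  (k_lip : exists2 L : R, 0 < L &
     forall x x' : R * R, (supnorm (k x \- k x')%R <= (L * `|x - x'|)%:E)%E)
  (k_diag : exists2 C : R, 0 <= C &
     forall r : R, (supnorm (k (r, r)) <= C%:E)%E)
  (c01 : 0 <= c <= 1)
  (c_max : forall x, phi x <= phi c)
  (D : R -> multiset (R * R)) (Dc : multiset (R * R))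
  (hD : forall r, 0 < r -> is_persistence_diagram F phi `[0, r] (D r))
  (hDc : is_persistence_diagram F phi `[c, c + 1] Dc) :
  supnorm (rhobar k eps p (D r) \- rhobar k eps p Dc) @[r --> +oo%R] --> 0%E.
Proof.
have p_gt0 : 0 < p := lt_trans ltr01 p_gt1.
have [C C_ge0 est] := rhobar_estimate phi_cont phi_per eps_gt0 p_gt0 k_lip
  k_diag c01 c_max hD hDc.
pose f r := supnorm (rhobar k eps p (D r) \- rhobar k eps p Dc).
have f_ge0 r : (0 <= f r)%E.
  (* The supremum dominates the absolute value at 0, hence is not [-oo]. *)
  apply: (@le_trans _ _ `|(rhobar k eps p (D r) \- rhobar k eps p Dc) 0|%:E).
    by rewrite lee_fin.
  by apply: ereal_sup_ubound; exists 0.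
have f_le r : c + 1 <= r -> (f r <= (C / (Num.truncn (r - c))%:R)%:E)%E.
  by move=> cr; apply/supnorm_le => t; apply: est.
have f_fin r : c + 1 <= r -> f r \is a fin_num.
  by move=> /f_le fr; rewrite ge0_fin_numE//; apply: le_lt_trans fr (ltry _).
apply/fine_cvgP; split.
  near=> r; apply: f_fin; near: r.
  by apply: nbhs_pinfty_ge; rewrite num_real.
apply/cvgr0Pnorm_lt => e e_gt0; near=> r.
(* This forces [truncn (r - c) > C / e], which brings the bound of [f_le] below [e]. *)
have r_big : c + 1 + C / e + 1 <= r.
  by near: r; apply: nbhs_pinfty_ge; rewrite num_real.
have Ce : 0 <= C / e by rewrite divr_ge0// ltW.
have cr : c + 1 <= r by lra.
rewrite /= -/(f r) ger0_norm ?fine_ge0//.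
have /fineK fr := f_fin r cr; rewrite -lte_fin fr.
apply: le_lt_trans (f_le r cr) _; rewrite lte_fin.
have rc0 : 0 <= r - c by lra.
have /andP[_] := Num.Theory.truncn_itv rc0; rewrite -natr1.
move: (Num.truncn _)%:R => N rN.
have N_gt0 : 0 < N by lra.
rewrite ltr_pdivrMr// mulrC -ltr_pdivrMr//; lra.
Unshelve. all: by end_near. Qed.
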